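(* Let $l\ge 27$ be an integer and let $r_l\in\{0,1,2\}$ with $l\equiv r_l \pmod 3$. For every $n\ge 2l^3$, $$pr(K_n,P_l)=\Big(\Big\lfloor\frac{l}{3}\Big\rfloor-1\Big)n-\binom{\lfloor l/3\rfloor}{2}+1+r_l.$$
   Context: $P_l$ denotes the path on $l$ vertices. A subgraph of an edge-colored graph is properly colored if any two adjacent edges receive different colors. $pr(K_n,G)$ denotes the maximum number of colors in an (arbitrary) edge-coloring of the complete graph $K_n$ that contains no properly colored copy of $G$. *)

(* Defs.v *)
From HB Require Import structures.
From mathcomp Require Import all_boot.
Set Implicit Arguments.
Unset Strict Implicit.
Unset Printing Implicit Defensive.

Record sgraph := SGraph {
  svertex :> finType;
  sedge : rel svertex;
  sedge_sym : symmetric sedge;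
  sedge_irr : irreflexive sedge }.

Definition edges (G : sgraph) : {set {set G}} :=
  [set [set p.1; p.2] | p : G * G & sedge p.1 p.2].

Definition complete_rel (n : nat) : rel 'I_n := fun x y => x != y.

Lemma complete_sym n : symmetric (@complete_rel n).
Proof. by move=> x y; rewrite /complete_rel eq_sym. Qed.

Lemma complete_irr n : irreflexive (@complete_rel n).
Proof. by move=> x; rewrite /complete_rel eqxx. Qed.

Definition complete_graph (n : nat) : sgraph :=
  SGraph (@complete_sym n) (@complete_irr n).

Definition path_rel (l : nat) : rel 'I_l :=
  fun x y => (x.+1 == y :> nat) || (y.+1 == x :> nat).

Lemma path_rel_sym l : symmetric (@path_rel l).
Proof. by move=> x y; rewrite /path_rel orbC. Qed.

Lemma path_rel_irr l : irreflexive (@path_rel l).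
Proof. by move=> x; rewrite /path_rel orbb eqn_leq ltnn. Qed.

(* [path_graph l] has l vertices, hence l - 1 edges. *)
Definition path_graph (l : nat) : sgraph :=
  SGraph (@path_rel_sym l) (@path_rel_irr l).

Section Coloring.
Variables (H : sgraph) (C : finType).

(* An edge-coloring of H is given by a function on all vertex sets; only its
   values on [edges H] are ever used. *)
Implicit Types (c : {set H} -> C) (F : {set {set H}}).

Definition num_colors c : nat := #|c @: edges H|.

Definition properly_colored c F : bool :=
  [forall e1 in F, forall e2 in F,
     (e1 != e2) && (e1 :&: e2 != set0) ==> (c e1 != c e2)].

(* [copy_edges f] is the edge set of the copy of G in H embedded by f. *)
Definition copy_edges (G : sgraph) (f : G -> H) : {set {set H}} :=
  [set f @: (e : {set G}) | e in edges G].

Definition has_pc_copy c (G : sgraph) : bool :=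
  [exists f : {ffun G -> H},
     [&& injectiveb f, copy_edges f \subset edges H
       & properly_colored c (copy_edges f)]].

End Coloring.

(* The maximum is taken over colorings with a fixed palette of #|edges H|
   colors; by [pr_max] and [pr_attained] below this is the maximum over
   colorings with arbitrary palettes. *)
Definition pr (H G : sgraph) : nat :=
  \max_(c : {ffun {set H} -> 'I_#|edges H|} | ~~ has_pc_copy c G) num_colors c.

Lemma pr_max (H G : sgraph) (C : finType) (c : {set H} -> C) :
  ~~ has_pc_copy c G -> num_colors c <= pr H G.
Proof.
move=> hc; have [E0|[e0 He0]] := set_0Vmem (edges H).
  by rewrite /num_colors E0 imset0 cards0.
pose A := c @: edges H.
have A0 : c e0 \in A by apply: imset_f.
have leA : #|A| <= #|edges H| by apply: leq_imset_card.
pose g (x : C) : 'I_#|edges H| := widen_ord leA (enum_rank_in A0 x).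
have gI : {in A &, injective g}.
  move=> x y xA yA /(congr1 val) /= /val_inj /(congr1 (@enum_val _ (mem A))).
  by rewrite !enum_rankK_in.
pose d : {ffun {set H} -> 'I_#|edges H|} := [ffun e => g (c e)].
have -> : num_colors c = num_colors d.
  rewrite /num_colors -(card_in_imset gI) /A -imset_comp.
  by congr #|pred_of_set _|; apply: eq_imset => e; rewrite ffunE.
apply: (@leq_bigmax_cond _ _
  (fun c : {ffun {set H} -> 'I_#|edges H|} => num_colors c) d).
apply: contra hc.
case/existsP=> f /and3P[fi fs /forall_inP fp].
apply/existsP; exists f; rewrite fi fs /=.
apply/forall_inP=> e1 h1; apply/forall_inP=> e2 h2; apply/implyP=> h.
have /forall_inP/(_ e2 h2)/implyP/(_ h) := fp e1 h1.
by apply: contra => /eqP E; rewrite !ffunE E.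
Qed.

Lemma pr_attained (H G : sgraph) (C : finType) (c : {set H} -> C) :
  ~~ has_pc_copy c G ->
  0 < num_colors c ->
  exists2 d : {ffun {set H} -> 'I_#|edges H|},
    ~~ has_pc_copy d G & num_colors d = pr H G.
Proof.
move=> hc c0; have := leq_trans c0 (pr_max hc).
rewrite /pr; case: (pickP (fun d : {ffun {set H} -> 'I_#|edges H|} =>
  ~~ has_pc_copy d G)) => [d0 hd0 _|no]; last by rewrite big_pred0.
have [|d hd ->] := @eq_bigmax_cond _ (fun d : {ffun {set H} -> 'I_#|edges H|} =>
  ~~ has_pc_copy d G) (fun d => num_colors d).
  by apply/card_gt0P; exists d0.
by exists d.
Qed.

(* Main.v *)
Require Import Defs.
From mathcomp Require Import all_boot zify.

(** Write [k = l %/ 3].  For the lower bound, make all edges at [k - 1] vertices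
    rainbow and colour the remaining edges lexicographically with [r + 1] colours;
    between two consecutive visits to the [k - 1] vertices a properly coloured
    path meets at most two of the generic vertices.

    For the upper bound, fix one edge of each colour (the set [E]) and suppose that
    there is no properly coloured path on [l] vertices.  If every edge inside a set
    has the colour owned by one of its ends, the set is a tournament, and a
    Hamiltonian directed path in it is properly coloured.  Playing this against
    greedy extension shows that a rainbow matching covers at most [(l - 1)^2]
    vertices, and that fewer than [k] vertices have degree at least [2 l] in [E].
    Counting edges, there are exactly [k - 1] such vertices (the set [A]), they have
    many common neighbours, and at least [r + 2] edges of [E] avoid [A].  Any two
    common neighbours can be inserted between two vertices of [A], which yields a
    path on [3 k - 1] vertices.  Three disjoint two-coloured cherries among the common
    neighbours lengthen this path by 3, so up to a few vertices the common
    neighbours span a monochromatic clique; its colour leaves [r + 1] edges avoiding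
    [A], and inserting them suitably gains the [r + 1] missing vertices. *)

Set Implicit Arguments.
Unset Strict Implicit.
Unset Printing Implicit Defensive.

(** * Properly coloured sequences and rainbow matchings *)

Section ProperSequences.
Variables (V C : finType) (c : {set V} -> C).

Definition col (x y : V) : C := c [set x; y].

(** Only consecutive edges are compared. On a duplicate-free sequence no other edges share a vertex,
    so [uniq] and [pc] together describe a properly coloured path. *)
Fixpoint pc (s : seq V) : bool :=
  if s is x :: t then
    (if t is y :: z :: _ then col x y != col y z else true) && pc t
  else true.

Lemma colC x y : col x y = col y x.
Proof. by rewrite /col setUC. Qed.

Lemma pc_cons3 x y z s :
  pc [:: x, y, z & s] = (col x y != col y z) && pc [:: y, z & s].
Proof. by []. Qed.

Lemma pc_tail x s : pc (x :: s) -> pc s.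
Proof. by case/andP. Qed.

Lemma pc_drop m s : pc s -> pc (drop m s).
Proof.
by elim: m s => [|m IH] [|x s] // /pc_tail/IH.
Qed.

(** The two pieces share the edge [x y], so each pair of consecutive edges lies inside one of
    them. *)
Lemma pc_overlap t x y s :
  pc (t ++ [:: x; y]) -> pc [:: x, y & s] -> pc (t ++ [:: x, y & s]).
Proof.
move=> + pxy; elim: t => [|u t IH] // put.
have {}IH := IH (pc_tail put).
rewrite cat_cons /=; apply/andP; split=> //.
by move: put; case: t {IH} => [|v [|w t]] /= /andP [].
Qed.

Lemma pc_rcons3 s x y z :
  pc (s ++ [:: x; y; z]) = pc (s ++ [:: x; y]) && (col x y != col y z).
Proof.
elim: s => [|u s IH]; first by rewrite /= andbT.
have -> : pc ((u :: s) ++ [:: x; y; z]) =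
    (if s ++ [:: x; y; z] is v :: w :: _ then col u v != col v w else true)
    && pc (s ++ [:: x; y; z]) by [].
rewrite IH andbA; congr (_ && _).
by case: s {IH} => [|v [|w s]].
Qed.

Lemma pc_rev s : pc (rev s) = pc s.
Proof.
elim: s => [|x [|y [|z s]] IH] //.
rewrite pc_cons3 -IH !rev_cons -!cats1 -!catA.
by rewrite pc_rcons3 andbC [col z y]colC [col y x]colC eq_sym.
Qed.

(** * Hamiltonian paths in tournaments of owned colours *)

Section Tournament.
Variable own : V -> C.

(** An arc leaves the vertex that owns its colour. The diagonal makes the relation total on a
    tournament, as sorting requires. *)
Definition own_rel : rel V := fun z z' => (z == z') || (col z z' == own z).

(** Along [L] each edge has the colour owned by its tail, and these colours are distinct. The last
    condition guards the junction at [w]. *)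
Lemma pc_tournament L w s :
    sorted own_rel (rcons L w) -> uniq (rcons L w) -> uniq (map own L) ->
    pc (w :: s) ->
    (if s is y :: _ then col w y \notin map own L else true) ->
  pc (L ++ w :: s).
Proof.
elim: L => [|z L IH] // sL uL oL pw nw; rewrite cat_cons.
have pL : pc (L ++ w :: s).
  apply: IH => //.
  - by move: sL; rewrite rcons_cons; apply: path_sorted.
  - by move: uL => /= /andP[].
  - by move: oL => /= /andP[].
  - by case: s pw nw => // y s _; rewrite /= inE negb_or => /andP[].
apply/andP; split=> //.
have e u v : own_rel u v -> u != v -> col u v = own u.
  by rewrite /own_rel => /orP[/eqP->|/eqP//]; rewrite eqxx.
case: L {IH pL} sL uL oL nw => [|z' L] /=.
  case: s pw => // y s _ /andP[/e ezw _]; rewrite !inE !andbT => /ezw -> _.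
  by rewrite eq_sym.
case/andP=> /e ezz' pz'; rewrite !inE negb_or -!andbA => /andP[/ezz' ->].
case: L pz' => [|z'' L] /=.
  by rewrite !andbT !inE orbF => /e ezw /andP[_ /ezw ->].
case/andP=> /e ezw _; rewrite !inE !negb_or -!andbA.
by case/and5P=> _ _ /ezw -> _ _ /andP[].
Qed.

(** Redei's theorem: sorting by a total relation, transitive or not, yields a list whose consecutive
    entries are related. *)
Lemma tournament_order (S : seq V) :
    uniq S ->
    {in S &, forall z z', z != z' -> (col z z' == own z) || (col z z' == own z')} ->
  exists2 L, perm_eq L S & sorted own_rel L.
Proof.
move=> uS tS; exists (sort own_rel S); first by rewrite perm_sort.
apply: (@sort_sorted_in _ (mem S)); last by apply/allP.
move=> x y xS yS; rewrite /own_rel; case: eqVneq => //= nxy.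
by rewrite [col y x]colC; apply: tS.
Qed.

End Tournament.

Section NoPath.
Variables (l : nat).
Hypothesis nopath : forall s : seq V, uniq s -> pc s -> size s < l.

(** * Rainbow matchings *)

Section Matching.
Variables (F : {set {set V}}).
Hypotheses (F2 : forall e, e \in F -> #|e| = 2) (trF : trivIset F)
  (cF : {in F &, injective c}).

Let own v := c (pblock F v).

Lemma mateP v : v \in cover F ->
  exists v', [/\ v' != v, v' \in cover F, pblock F v' = pblock F v
               & pblock F v = [set v; v']].
Proof.
move=> vF; have BF := pblock_mem vF; have := F2 BF.
move/eqP/cards2P=> [x [y [nxy eB]]].
have vB : v \in pblock F v by rewrite mem_pblock.
have [xB yB] : x \in pblock F v /\ y \in pblock F v by rewrite eB !inE !eqxx orbT.
have xF : x \in cover F by apply/bigcupP; exists (pblock F v).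
have yF : y \in cover F by apply/bigcupP; exists (pblock F v).
have ex : pblock F x = pblock F v by apply: def_pblock.
have ey : pblock F y = pblock F v by apply: def_pblock.
have : v \in [set x; y] by rewrite -eB.
rewrite !inE => /orP[/eqP ev|/eqP ev].
  by exists y; split=> //; [rewrite ev eq_sym | rewrite eB ev].
by exists x; split=> //; [rewrite ev | rewrite eB ev setUC].
Qed.

Lemma own_inj u v : u \in cover F -> v \in cover F -> own u = own v ->
  v \in pblock F u.
Proof.
move=> uF vF /cF e; rewrite (e (pblock_mem uF) (pblock_mem vF)).
by rewrite mem_pblock.
Qed.

Definition neutral u v := (col u v != own u) && (col u v != own v).

(* Paths alternating between matching edges and neutral edges, extended at
   their head, which is always the second vertex of a matching edge. *)
Definition alternating (F1 : {set {set V}}) (s : seq V) :=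
  [/\ uniq s, pc s, {subset s <= cover F1},
      forall v, v \in s -> {subset pblock F v <= s}
    & if s is y :: s' then
        if s' is x :: _ then pblock F y = [set y; x] else False
      else False].

Definition stuck (F1 : {set {set V}}) (s : seq V) :=
  if s is y :: _ then
    [forall w in cover F1, (w \notin s) ==> ~~ neutral y w] else true.

Lemma coverS (F1 F' : {set {set V}}) : F1 \subset F' ->
  {subset cover F1 <= cover F'}.
Proof.
move=> sF v /bigcupP[B BF vB]; apply/bigcupP; exists B => //.
exact: (subsetP sF).
Qed.

Lemma cover_sub (F1 : {set {set V}}) : F1 \subset F ->
  {subset cover F1 <= cover F}.
Proof. exact: coverS. Qed.

Lemma pblock_sub (F1 : {set {set V}}) v : F1 \subset F -> v \in cover F1 ->
  pblock F v \in F1.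
Proof.
move=> sF /bigcupP[B BF vB]; rewrite (def_pblock trF _ vB) //.
exact: (subsetP sF).
Qed.

Lemma alternating_start (F1 : {set {set V}}) v : F1 \subset F ->
  v \in cover F1 -> exists s, alternating F1 s.
Proof.
move=> sF vF1; have vF := cover_sub sF vF1.
have [v' [nv v'F ev' ev]] := mateP vF.
exists [:: v; v']; split=> //=.
- by rewrite inE eq_sym nv.
- move=> u; rewrite !inE => u2; apply/bigcupP; exists (pblock F v).
    exact: pblock_sub.
  by rewrite ev !inE.
- move=> u; rewrite !inE => /orP[] /eqP->; rewrite ?ev' ev => w; by rewrite !inE.
Qed.

(** A neutral edge from the head to a new vertex [w] can be followed by the matching edge at [w],
    since its colour differs from both matching colours. As [s] contains the mates of its vertices,
    the mate of [w] is new as well. *)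
Lemma alternating_extend (F1 : {set {set V}}) s : F1 \subset F ->
  alternating F1 s -> ~~ stuck F1 s ->
  exists2 s', alternating F1 s' & size s < size s'.
Proof.
case: s => [|y [|x s]] sF [us ps sub cl ey] // nst.
have [w /and3P[wF1 ws nw]] : exists w,
    [&& w \in cover F1, w \notin [:: y, x & s] & neutral y w].
  move: nst; rewrite negb_forall => /existsP[w]; rewrite negb_imply.
  by case/andP=> wF; rewrite negb_imply negbK => /andP[ws nw]; exists w; apply/and3P.
have wF := cover_sub sF wF1.
have yF : y \in cover F by apply: (cover_sub sF); apply: sub; rewrite inE eqxx.
have [w' [nw' w'F ew' ew]] := mateP wF.
have w's : w' \notin [:: y, x & s].
  apply: contra ws => w's; apply: (cl w') => //.
  by rewrite ew' ew !inE eqxx.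
exists [:: w', w, y, x & s] => //; split.
- by rewrite cons_uniq inE negb_or nw' w's cons_uniq ws us.
- rewrite !pc_cons3 ps andbT; case/andP: nw; rewrite /own ew ey => n1 n2.
  by rewrite [col w' w]colC [col w y]colC eq_sym; apply/andP.
- move=> u; rewrite inE => /orP[/eqP->|].
    apply/bigcupP; exists (pblock F w); first exact: pblock_sub.
    by rewrite ew !inE eqxx orbT.
  by rewrite inE => /orP[/eqP->|/sub].
- move=> u; rewrite inE => /orP[/eqP->|].
    by rewrite ew' ew => t; rewrite !inE => /orP[]->; rewrite ?orbT.
  rewrite inE => /orP[/eqP->|uv t tu].
    by rewrite ew => t; rewrite !inE => /orP[]->; rewrite ?orbT.
  by rewrite inE [_ \in w :: _]inE (cl u) ?orbT.
- by rewrite ew' ew setUC.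
Qed.

Lemma alternating_stuck (F1 : {set {set V}}) v : F1 \subset F ->
  v \in cover F1 -> exists2 s, alternating F1 s & stuck F1 s.
Proof.
move=> sF vF; have [s0 as0] := alternating_start sF vF.
(* [d] bounds the number of extensions still possible, as no path reaches [l] vertices. *)
suff: forall d s, alternating F1 s -> l <= size s + d ->
    exists2 s, alternating F1 s & stuck F1 s.
  by move=> /(_ l s0 as0); apply; rewrite leq_addl.
elim=> [|d IH] s als; rewrite ?addn0 => ls.
  by case: (als) => us ps _ _ _; move: (nopath us ps); rewrite ltnNge ls.
have [st|nst] := boolP (stuck F1 s); first by exists s.
have [s' als' lt] := alternating_extend sF als nst.
by apply: (IH s') => //; apply: leq_trans ls _; rewrite addnS -addSn leq_add2r.
Qed.

(* The heads of successively peeled stuck paths are pairwise not neutral. *)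
Lemma peel j (F1 : {set {set V}}) : F1 \subset F -> j * l.-1 < 2 * #|F1| ->
  exists L, [/\ size L = j.+1, uniq (map own L), {subset L <= cover F1}
    & {in L &, forall u v, u != v -> ~~ neutral u v}].
Proof.
elim: j F1 => [|j IH] F1 sF lt.
  have /card_gt0P[B BF] : 0 < #|F1| by rewrite lt0n; apply: contraTneq lt => ->.
  have /F2 B2 := subsetP sF _ BF.
  have /card_gt0P[v vB] : 0 < #|B| by rewrite B2.
  exists [:: v]; split=> //.
    by move=> u; rewrite inE => /eqP->; apply/bigcupP; exists B.
  by move=> u w; rewrite !inE => /eqP-> /eqP->; rewrite eqxx.
have /card_gt0P[B BF] : 0 < #|F1| by rewrite lt0n; apply: contraTneq lt => ->.
have /F2 B2 := subsetP sF _ BF.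
have /card_gt0P[v vB] : 0 < #|B| by rewrite B2.
have vF : v \in cover F1 by apply/bigcupP; exists B.
have [[|y s] als st] := alternating_stuck sF vF; first by case: als.
case: (als) => us ps ss cl _; have ls := nopath us ps.
pose F' := [set B in F1 | [disjoint B & y :: s]].
have sF' : F' \subset F1 by apply/subsetP=> b; rewrite inE => /andP[].
have sFF : F' \subset F by apply: subset_trans sF' sF.
have cF' w : w \in cover F' -> w \notin y :: s.
  case/bigcupP=> b; rewrite inE => /andP[_ /pred0P d] wb.
  by move: (d w) => /=; rewrite wb /= => ->.
(* An edge of [F1] outside [F'] meets the stuck path, hence lies in it by closure under mates; the
   path has at most [l.-1] vertices. *)
have small : 2 * #|F1 :\: F'| <= l.-1.
  have sD : F1 :\: F' \subset F by apply: subset_trans sF; apply: subsetDl.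
  have /eqP e := trivIsetS sD trF.
  have : #|cover (F1 :\: F')| <= #|y :: s|.
    apply/subset_leq_card/subsetP=> w /bigcupP[b].
    rewrite 3!inE negb_and => /andP[+ bF1] wb; rewrite bF1 /=.
    case/pred0Pn=> u /andP[/= ub us']; apply: (cl u) => //.
    by rewrite (def_pblock trF (subsetP sF _ bF1) ub).
  rewrite -e (eq_bigr (fun=> 2)); last first.
    by move=> b bD; apply: F2; apply: (subsetP sD).
  rewrite sum_nat_const mulnC (card_uniqP us) => h.
  by apply: leq_trans h _; rewrite -ltnS (ltn_predK ls).
have cD : #|F1| = #|F'| + #|F1 :\: F'|.
  by rewrite -(cardsID F' F1) (setIidPr sF').
have [|L [sL oL LF nL]] := IH F' sFF; first by move: lt small cD; rewrite mulSn; clear; lia.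
have yF : y \in cover F by apply: (cover_sub sF); apply: ss; rewrite inE eqxx.
exists (y :: L); split.
- by rewrite /= sL.
- rewrite /= oL andbT; apply/mapP=> -[w /LF wF /own_inj wy].
  have := cF' _ wF; rewrite (cl y) ?inE ?eqxx //.
  by apply: wy => //; apply: cover_sub wF.
- move=> w; rewrite inE => /orP[/eqP->|/LF]; first by apply: ss; rewrite inE eqxx.
  exact: (coverS sF').
- have nyw w : w \in L -> ~~ neutral y w.
    move=> /LF wF; have /forall_inP/(_ w) := st; rewrite (cF' _ wF) /=; apply.
    exact: (coverS sF').
  move=> u w; rewrite !inE => /orP[/eqP->|uL] /orP[/eqP->|wL]; rewrite ?eqxx //.
  + by move=> _; apply: nyw.
  + by move=> _; rewrite /neutral colC andbC; apply: nyw.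
  + exact: nL.
Qed.

(** If more vertices were covered, peeling would yield [l] heads that are pairwise not neutral and
    own distinct colours. They form a tournament, whose Hamiltonian path is properly coloured. *)
Lemma rainbow_matching_bound : #|cover F| <= l.-1 * l.-1.
Proof.
have /eqP <- := trF; rewrite (eq_bigr (fun=> 2)) ?sum_nat_const; last exact: F2.
rewrite leqNgt mulnC; apply/negP=> lt.
have [|L [sL oL LF nL]] := peel (j := l.-1) (subxx F); first by lia.
have uL := map_uniq oL.
have [|L' pL sL'] := @tournament_order own L uL.
  move=> u v uL' vL' /(nL _ _ uL' vL'); rewrite /neutral negb_and !negbK.
  by [].
have uL' : uniq L' by rewrite (perm_uniq pL).
have szL' : size L' = l.-1.+1 by rewrite (perm_size pL).
case/lastP: L' => // L' w in pL sL' uL' szL' *.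
have := @pc_tournament own L' w [::] sL' uL'.
rewrite cats1 => p.
suff : size (rcons L' w) < l by rewrite szL'; clear; lia.
apply: nopath => //; apply: p => //.
have : uniq (map own (rcons L' w)) by rewrite (perm_uniq (perm_map own pL)).
by rewrite map_rcons rcons_uniq => /andP[].
Qed.

End Matching.
End NoPath.
End ProperSequences.

(** * Vertices of large rainbow degree *)

Lemma card_avoid (T : finType) (A : {set T}) (s : seq T) :
  #|A| <= #|[set x in A | x \notin s]| + size s.
Proof.
have sA : A \subset [set x in A | x \notin s] :|: [set x in s].
  by apply/subsetP=> x xA; rewrite !inE xA; case: (x \in s).
apply: leq_trans (subset_leq_card sA) _; apply: leq_trans (leq_card_setU _ _) _.
by rewrite leq_add2l cardsE card_size.
Qed.

Section RainbowStars.
Variables (V C : finType) (c : {set V} -> C) (l : nat).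
Hypothesis nopath : forall s : seq V, uniq s -> pc c s -> size s < l.
Variable E : {set {set V}}.
Hypotheses (E2 : forall e, e \in E -> #|e| = 2) (cE : {in E &, injective c}).

Local Notation col := (col c).
Local Notation pc := (pc c).

Definition adj u v := [set u; v] \in E.
Definition nbr v := [set u | adj v u].

Lemma adjC u v : adj u v = adj v u.
Proof. by rewrite /adj setUC. Qed.

Lemma adj_neq u v : adj u v -> u != v.
Proof. by move/E2; rewrite cards2; case: eqP. Qed.

Lemma star_inj a z z' : adj a z -> adj a z' -> col a z = col a z' -> z = z'.
Proof.
move=> az az' /cE e; have {}e := e az az'.
have : z \in [set a; z'] by rewrite -e !inE eqxx orbT.
rewrite !inE => /orP[/eqP za|/eqP//].
by move: (adj_neq az); rewrite za eqxx.
Qed.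

Lemma stars_disjoint a z b w : adj a z -> adj b w -> a != b -> a != w ->
  col a z != col b w.
Proof.
move=> az bw nab naw; apply/eqP=> /cE e; have {}e := e az bw.
have : a \in [set b; w] by rewrite -e !inE eqxx.
by rewrite !inE (negPf nab) (negPf naw).
Qed.

Implicit Types (a x y z w : V) (s t : seq V).

(* [state a s]: the path [a :: s], growing at its head [a], reached [a] through an
   edge of [E], so it can leave along any other edge of [E]. *)
Definition state a s := [/\ uniq (a :: s), pc (a :: s)
  & if s is z0 :: _ then adj a z0 else true].

Lemma state_cons a s z : state a s -> adj a z -> z \notin s ->
  uniq [:: z, a & s] /\ pc [:: z, a & s].
Proof.
case=> us ps es az zs; split.
  by rewrite cons_uniq us inE negb_or zs eq_sym (adj_neq az).
case: s us ps es zs => [|z0 s] // us ps es.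
rewrite inE negb_or pc_cons3 ps andbT => /andP[nz _].
by apply: contraNneq nz; rewrite colC => /star_inj->.
Qed.

Lemma state_link a s t : state a s -> uniq (t ++ a :: s) -> pc (rcons t a) ->
  adj a (last a t) -> pc (t ++ a :: s).
Proof.
move=> sas; case/lastP: t => [|t x]; first by case: sas.
rewrite last_rcons cat_rcons -!cats1 -catA /= => u p ax.
apply: pc_overlap => //; apply: (proj2 (state_cons sas ax _)).
move: u; rewrite cat_uniq => /and3P[_ _].
by rewrite /= inE negb_or -andbA => /and3P[].
Qed.

(** Both [a, z, z'] and [a, z', z] are then properly coloured. If no pair is good, every [col z z']
    is owned by an end under [own := col a], which is a tournament. *)
Definition good a z z' := [&& z != z', col z z' != col a z & col z z' != col a z'].

Lemma no_good_tournament a (S : {set V}) :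
    {in S, forall z, adj a z} -> 0 < #|S| ->
    ~~ [exists z in S, exists z' in S, good a z z'] ->
  exists L w, [/\ rcons L w =i S, size (rcons L w) = #|S|,
    sorted (own_rel c (col a)) (rcons L w), uniq (rcons L w)
    & uniq (map (col a) (rcons L w))].
Proof.
move=> aS S0 ng.
have [|L pL sL] := @tournament_order _ _ c (col a) (enum S) (enum_uniq _).
  move=> z z'; rewrite !mem_enum => zS z'S nz; apply: contraNT ng => bad.
  apply/exists_inP; exists z => //; apply/exists_inP; exists z' => //.
  by rewrite /good nz -negb_or.
have uL : uniq L by rewrite (perm_uniq pL) enum_uniq.
have szL : size L = #|S| by rewrite (perm_size pL) -cardE.
have LS : L =i S by move=> x; rewrite (perm_mem pL) mem_enum.
case/lastP: L => [|L w] in pL sL uL szL LS *; first by rewrite -szL in S0.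
exists L, w; split=> //.
rewrite map_inj_in_uniq // => z z' zL z'L; apply: star_inj; apply: aS;
  by rewrite -LS.
Qed.

Lemma tournament_bound own (S : {set V}) L w t :
    rcons L w =i S -> size (rcons L w) = #|S| ->
    sorted (own_rel c own) (rcons L w) -> uniq (rcons L w) ->
    uniq (map own (rcons L w)) ->
    pc (w :: t) -> uniq t -> {in S, forall z, z \notin t} ->
    (if t is y :: _ then col w y \notin map own L else true) ->
  #|S| + size t < l.
Proof.
move=> LS sz sL uL oL pw ut St hd.
have : uniq (rcons L w ++ t).
  rewrite cat_uniq uL ut andbT /=; apply/hasPn=> x xt.
  by apply: contraL xt; rewrite LS; apply: St.
rewrite cat_rcons => u; rewrite -sz -size_cat cat_rcons; apply: nopath => //.
apply: (@pc_tournament _ _ _ own) => //.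
by move: oL; rewrite map_rcons rcons_uniq => /andP[].
Qed.

(** Without a good pair [S] would be a tournament, and its Hamiltonian path followed by [a :: s]
    would have at least [l] vertices. *)
Lemma good_pair a s (S : {set V}) :
    state a s -> {in S, forall z, adj a z} -> {in S, forall z, z \notin s} ->
    l <= #|S| + (size s).+1 ->
  exists z z', [/\ z \in S, z' \in S & good a z z'].
Proof.
move=> sas aS Ss ls; have [us ps _] := sas; have lt := nopath us ps.
case: (boolP [exists z in S, exists z' in S, good a z z']) => [|ng].
  by case/exists_inP=> z zS /exists_inP[z' z'S g]; exists z, z'.
have S0 : 0 < #|S| by move: lt => /=; lia.
have [L [w [LS sz sL uL oL]]] := no_good_tournament aS S0 ng.
have wS : w \in S by rewrite -LS mem_rcons inE eqxx.
have [_ pw] := state_cons sas (aS _ wS) (Ss _ wS).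
suff : #|S| + (size s).+1 < l by rewrite ltnNge ls.
apply: (tournament_bound LS sz sL uL oL pw us) => [z zS|].
  by rewrite inE negb_or Ss // eq_sym (adj_neq (aS _ zS)).
rewrite colC; move: oL; rewrite map_rcons rcons_uniq; by case/andP.
Qed.

(** The vertices of [B] are kept free for later links. A good pair [z], [z'] at [a] gives two ways
    to arrive at [z'], directly or through [z]; from there the path continues to a neighbour of
    [a2]. *)
Lemma link a s a2 (B : seq V) :
    state a s -> a2 \notin a :: s -> {in B, forall b, b \notin a :: s} ->
    a2 \notin B -> 2 * l <= #|nbr a| -> 2 * l <= #|nbr a2| -> size B + 3 <= l ->
  exists s', [/\ state a2 s', size s + 3 <= size s'
    & {in B, forall b, b \notin a2 :: s'}].
Proof.
move=> sas a2s Bs a2B da da2 lB; have [us ps _] := sas; have lt := nopath us ps.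
rewrite /= in lt.
have [z [z' [zS z'S gz]]] : exists z z',
    [/\ z \in [set x in nbr a | x \notin s ++ a2 :: B],
        z' \in [set x in nbr a | x \notin s ++ a2 :: B] & good a z z'].
  apply: (good_pair sas) => [z|z|].
  - by rewrite !inE => /andP[].
  - by rewrite !inE mem_cat negb_or => /and3P[].
  - by have := card_avoid (nbr a) (s ++ a2 :: B); rewrite size_cat /=; lia.
have fresh x : x \in [set x in nbr a | x \notin s ++ a2 :: B] ->
    [/\ adj a x, x \notin a :: s, x != a2 & x \notin B].
  rewrite !inE mem_cat inE !negb_or => /and4P[ax xs x2 xB].
  by rewrite ax xs x2 xB eq_sym (adj_neq ax).
have [az zs z2 zB] := fresh z zS; have [az' z's z'2 z'B] := fresh z' z'S.
case/and3P: gz => nz gz gz'.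
have [uz pz] : uniq [:: z, a & s] /\ pc [:: z, a & s].
  by apply: state_cons => //; move: zs; rewrite inE negb_or => /andP[].
have [uz' pz'] : uniq [:: z', a & s] /\ pc [:: z', a & s].
  by apply: state_cons => //; move: z's; rewrite inE negb_or => /andP[].
have uzz : uniq [:: z', z, a & s].
  by rewrite cons_uniq uz inE negb_or eq_sym nz z's.
have pzz : pc [:: z', z, a & s].
  by rewrite pc_cons3 pz andbT colC [col z a]colC.
pose T := [set x in nbr a2 | x \notin [:: z, z', a & s] ++ B].
have freshT x : x \in T ->
    [/\ adj a2 x, x \notin [:: z', z, a & s], x != a2 & x \notin B].
  rewrite inE mem_cat negb_or => /and3P[]; rewrite inE => ax xs xB.
  split=> //; last by rewrite eq_sym (adj_neq ax).
  by move: xs; rewrite !inE orbCA.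
have na2 : a2 != a by move: a2s; rewrite inE negb_or => /andP[].
have own_ne x w : adj a x -> a2 != x -> w \in T -> col a2 w != col a x.
  by move=> ax nx /freshT[a2w _ _ _]; apply: stars_disjoint.
have cardT : 2 * l <= #|T| + (size s + 3 + size B).
  have := card_avoid (nbr a2) ([:: z, z', a & s] ++ B); rewrite -/T size_cat.
  by move=> h; apply: leq_trans da2 (leq_trans h _); rewrite /= !addSn addn3.
clearbody T.
have a2z : a2 \notin [:: z', z, a & s].
  by rewrite inE negb_or eq_sym z'2 inE negb_or eq_sym z2.
have Bz b : b \in B -> b \notin [:: z', z, a & s].
  move=> bB; rewrite inE negb_or inE negb_or Bs // andbT.
  by rewrite (memPn z'B) // (memPn zB).
have fin t w : w \in T -> uniq (w :: t) -> pc [:: a2, w & t] ->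
    size s + 3 <= (size t).+1 ->
    (forall x, x \in t -> (x \in T) || (x \in [:: z', z, a & s])) ->
  exists s', [/\ state a2 s', size s + 3 <= size s'
    & {in B, forall b, b \notin a2 :: s'}].
  move=> wT ut pt szt tsub; exists (w :: t).
  have a2t : a2 \notin w :: t.
    apply/negP; rewrite inE => /orP[/eqP e|/tsub/orP[|]].
    - by have [_ _ + _] := freshT w wT; rewrite e eqxx.
    - by case/freshT=> _ _; rewrite eqxx.
    - by rewrite (negPf a2z).
  have [a2w wz _ wB] := freshT w wT.
  split=> //; first by split=> //; rewrite cons_uniq a2t.
  move=> b bB; rewrite inE negb_or (memPn a2B) //= inE negb_or (memPn wB) //=.
  apply/negP=> /tsub/orP[/freshT[_ _ _]|]; first by rewrite bB.
  by rewrite (negPf (Bz _ bB)).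
have notT w x : w \in T -> x \in [:: z', z, a & s] -> w != x.
  by case/freshT=> _ + _ _ => wz xz; apply: contraNneq wz => ->.
have uw w : w \in T -> uniq [:: w, z', z, a & s].
  by move=> wT; rewrite cons_uniq uzz andbT; case: (freshT _ wT).
have uw' w : w \in T -> uniq [:: w, z', a & s].
  move=> wT; rewrite cons_uniq uz' andbT; case: (freshT _ wT) => _ + _ _.
  by rewrite !inE !negb_or => /and4P[-> _ -> ->].
have sub' x : x \in [:: z', a & s] -> (x \in T) || (x \in [:: z', z, a & s]).
  by rewrite !inE => /or3P[]->; rewrite !orbT.
(* If [col z' w] clashes with neither side, the connection is [a], [z'], [w], [a2]. *)
have neutral_link w : w \in T -> col z' w != col a z' -> col z' w != col a2 w ->
  exists s', [/\ state a2 s', size s + 3 <= size s'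
    & {in B, forall b, b \notin a2 :: s'}].
  move=> wT n1 n2; apply: (fin [:: z', a & s] w wT (uw' w wT)) => [||x /sub'//].
    rewrite !pc_cons3 pz' andbT [col w z']colC [col z' a]colC n1.
    by rewrite eq_sym n2.
  by rewrite /=; clear; lia.
have pw1 w : w \in T -> col z' w = col a z' -> pc [:: w, z', z, a & s].
  by move=> wT e; rewrite pc_cons3 pzz andbT colC e [col z' z]colC eq_sym.
have pw2 w : w \in T -> col z' w = col a2 w -> pc [:: w, z', a & s].
  move=> wT e; rewrite pc_cons3 pz' andbT colC e [col z' a]colC.
  by apply: own_ne => //; rewrite eq_sym.
(* With a good pair at [a2], a clash with [col a z'] is avoided by the detour through [z], and a
   clash with [col a2 w] by the detour through [w']. *)
case: (boolP [exists w in T, exists w' in T, good a2 w w']) => [|ng].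
  case/exists_inP=> w wT /exists_inP[w' w'T /and3P[nw gw gw']].
  have [e1|n1] := eqVneq (col z' w) (col a z').
    apply: (fin [:: z', z, a & s] w wT (uw w wT)) => [||x ->]; last by rewrite orbT.
      rewrite pc_cons3 pw1 // andbT colC [col w z']colC e1 [col w a2]colC.
      by apply: own_ne => //; rewrite eq_sym.
    by rewrite /=; clear; lia.
  have [e2|n2] := eqVneq (col z' w) (col a2 w); last exact: neutral_link n1 n2.
  apply: (fin [:: w, z', a & s] w' w'T) => [|||x].
  - rewrite cons_uniq uw' // andbT inE negb_or eq_sym nw.
    by have := uw' _ w'T; rewrite cons_uniq => /andP[].
  - rewrite !pc_cons3 pz' andbT [col w' w]colC [col w z']colC eq_sym gw'.
    by rewrite e2 gw [col z' a]colC own_ne // eq_sym.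
  - by rewrite /=; clear; lia.
  - by rewrite inE => /orP[/eqP->|/sub'//]; rewrite wT.
(* Without a good pair [T] is a tournament. In either clash its Hamiltonian path could be attached
   to the path through [z'], giving at least [l] vertices. *)
have aT : {in T, forall w, adj a2 w} by move=> w /freshT[].
have T0 : 0 < #|T| by move: cardT lt lB; clear; lia.
have [L [w [LT sz sL uL oL]]] := no_good_tournament aT T0 ng.
have wT : w \in T by rewrite -LT mem_rcons inE eqxx.
have owL : col a2 w \notin map (col a2) L.
  by move: oL; rewrite map_rcons rcons_uniq => /andP[].
have [e1|n1] := eqVneq (col z' w) (col a z').
  have := tournament_bound LT sz sL uL oL (pw1 w wT e1) uzz.
  move=> h; have : #|T| + size [:: z', z, a & s] < l.
    apply: h => [x /freshT[]//|]; rewrite colC e1; apply/mapP=> -[x xL /esym/eqP].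
    apply/negP/own_ne => //; first by rewrite eq_sym.
    by rewrite -LT mem_rcons inE xL orbT.
  by rewrite /=; move: cardT lt lB; clear; lia.
have [e2|n2] := eqVneq (col z' w) (col a2 w); last exact: neutral_link n1 n2.
have := tournament_bound LT sz sL uL oL (pw2 w wT e2) uz'.
move=> h; have : #|T| + size [:: z', a & s] < l.
  apply: h => [x /freshT[_ + _ _]|]; last by rewrite colC e2.
  by rewrite !inE !negb_or => /and4P[-> _ -> ->].
by rewrite /=; move: cardT lt lB; clear; lia.
Qed.

Lemma links a s (B : seq V) :
    state a s -> {in B, forall b, b \notin a :: s} -> uniq B ->
    2 * l <= #|nbr a| -> {in B, forall b, 2 * l <= #|nbr b|} -> size B + 2 <= l ->
  exists a' s', [/\ state a' s', size s + 3 * size B <= size s'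
    & 2 * l <= #|nbr a'|].
Proof.
elim: B a s => [|b B IH] a s sas Bs uB da dB lB.
  by exists a, s; rewrite muln0 addn0.
case/andP: uB => bB uB; rewrite /= in lB.
have db : 2 * l <= #|nbr b| by apply: dB; rewrite inE eqxx.
have [|||s1 [sb sz1 B1]] := link (B := B) sas _ _ bB da db.
- by apply: Bs; rewrite inE eqxx.
- by move=> x xB; apply: Bs; rewrite inE xB orbT.
- by lia.
have [||a' [s' [sa' sz' da']]] := IH b s1 sb B1 uB db.
- by move=> x xB; apply: dB; rewrite inE xB orbT.
- by lia.
by exists a', s'; split=> //; rewrite /=; lia.
Qed.

(** From [k] such vertices one gets a path: the first with two neighbours before it, [k - 1] links
    adding at least three vertices each, and two final neighbours. That is at least [3 * k + 2]
    vertices. *)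
Lemma big_vertices_bound (k : nat) (B : {set V}) :
    {in B, forall b, 2 * l <= #|nbr b|} -> 0 < k -> l <= 3 * k + 2 -> k + 2 <= l ->
  #|B| < k.
Proof.
move=> dB k0 lk kl; rewrite ltnNge; apply/negP=> kB.
have [e se su] : exists2 e, size e = k & uniq e /\ {subset e <= B}.
  exists (take k (enum B)); first by rewrite size_takel // -cardE.
  by split=> [|x /mem_take]; rewrite ?take_uniq ?enum_uniq // mem_enum.
case: e se su => [se _|a e se [/andP[ae ue] eB]]; first by rewrite -se in k0.
have da : 2 * l <= #|nbr a| by apply/dB/eB; rewrite inE eqxx.
have sta : state a [::] by [].
rewrite /= in se.
have [z [z' [zS z'S /and3P[nz gz gz']]]] : exists z z',
    [/\ z \in [set x in nbr a | x \notin e],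
        z' \in [set x in nbr a | x \notin e] & good a z z'].
  apply: (good_pair sta) => [z|z|] //; first by rewrite !inE => /andP[].
  by have := card_avoid (nbr a) e; move: da kl se; clear; rewrite /=; lia.
move: zS z'S; rewrite !inE => /andP[az ze] /andP[az' z'e].
have sta2 : state a [:: z; z'].
  split=> //; first by rewrite /= !inE !negb_or nz (adj_neq az) (adj_neq az').
  by rewrite pc_cons3 eq_sym gz.
have [|//|||a' [s' [sa' sz' da']]] := links (B := e) sta2 _ _ da.
- move=> b be; rewrite !inE !negb_or (memPn ae) // (memPn ze) //.
  by rewrite (memPn z'e).
- by move=> b be; apply/dB/eB; rewrite inE be orbT.
- by move: se kl; clear; lia.
rewrite /= in sz'.
have [us ps _] := sa'; have lt := nopath us ps; rewrite /= in lt.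
have [y [y' [yS y'S /and3P[ny gy gy']]]] : exists z z',
    [/\ z \in [set x in nbr a' | x \notin s'],
        z' \in [set x in nbr a' | x \notin s'] & good a' z z'].
  apply: (good_pair sa') => [y|y|] //; rewrite ?inE; try by case/andP.
  by have := card_avoid (nbr a') s'; move: da' lt; clear; lia.
move: yS y'S; rewrite !inE => /andP[ay ys] /andP[ay' y's].
have [uy py] := state_cons sa' ay ys.
suff : size [:: y', y, a' & s'] < l by move: se sz' lk; clear; rewrite /=; lia.
apply: nopath.
  by rewrite cons_uniq uy !inE !negb_or eq_sym ny y's eq_sym (adj_neq ay').
by rewrite pc_cons3 py andbT colC [col y a']colC.
Qed.

End RainbowStars.

(** * Common neighbours *)

Section CommonNeighbours.
Variables (V C : finType) (c : {set V} -> C) (l : nat).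
Hypothesis nopath : forall s : seq V, uniq s -> pc c s -> size s < l.
Variable E : {set {set V}}.
Hypotheses (E2 : forall e, e \in E -> #|e| = 2) (cE : {in E &, injective c}).
Variable A : {set V}.

Local Notation col := (col c).
Local Notation pc := (pc c).
Local Notation adj := (adj E).
Local Notation state := (state c E).
Implicit Types (a x y z w : V) (s t : seq V) (Q Z : {set V}).

Definition complete_to Q := {in A & Q, forall a z, adj a z}.

Lemma complete_to_disjoint Q z : complete_to Q -> z \in Q -> z \notin A.
Proof.
by move=> AQ zQ; apply/negP=> zA; have := adj_neq E2 (AQ z z zA zQ); rewrite eqxx.
Qed.

Lemma pair_start a z z' : adj a z -> adj a z' -> z != z' ->
  (col a z != col z z') || (col a z' != col z z').
Proof.
move=> az az' nz; rewrite -negb_and; apply: contra nz => /andP[/eqP e1 /eqP e2].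
by apply/eqP/(star_inj E2 cE az az'); rewrite e1 e2.
Qed.

Lemma col_swap a a2 z : adj a z -> adj a2 z -> a != a2 -> col a z != col a2 z.
Proof.
rewrite [adj a z]adjC [adj a2 z]adjC => za za2.
apply: contraNneq; rewrite (colC c a) (colC c a2).
by move/(star_inj E2 cE za za2)->.
Qed.

Lemma state_join a s a2 x t : state a s ->
    uniq (a2 :: (x :: t) ++ a :: s) -> pc (a2 :: rcons (x :: t) a) ->
    adj a2 x -> adj a (last x t) ->
  state a2 ((x :: t) ++ a :: s).
Proof.
move=> sas u p a2x ax; split=> //.
exact: (state_link E2 cE sas (t := a2 :: x :: t)).
Qed.

(** The four edges from [a] and [a2] to [z] and [z'] have distinct colours, so [col z z'] blocks at
    most one of the two orders. *)
Lemma link_pair a s a2 z z' : state a s -> adj a z -> adj a z' -> adj a2 z ->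
    adj a2 z' -> z != z' -> a2 \notin a :: s -> z \notin s -> z' \notin s ->
  exists2 t, perm_eq t [:: z; z'] & state a2 (t ++ a :: s).
Proof.
move=> sas az az' a2z a2z' nz na2 zs z's; have [us _ _] := sas.
have na : a2 != a by move: na2; rewrite inE negb_or => /andP[].
have u t : perm_eq t [:: z; z'] -> uniq (a2 :: t ++ a :: s).
  move=> pt; rewrite cons_uniq mem_cat negb_or na2 (perm_mem pt) andbT.
  rewrite !inE negb_or (adj_neq E2 a2z) (adj_neq E2 a2z') /=.
  rewrite cat_uniq (perm_uniq pt) us andbT.
  apply/andP; split; first by rewrite /= inE nz.
  apply/hasPn=> x; rewrite inE (perm_mem pt) !inE negb_or => /orP[/eqP->|xs].
    by rewrite (adj_neq E2 az) (adj_neq E2 az').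
  by rewrite (memPn zs) // (memPn z's).
have h : forall x y, perm_eq [:: x; y] [:: z; z'] ->
    adj a x -> adj a2 y -> col a x != col x y -> col x y != col a2 y ->
    exists2 t, perm_eq t [:: z; z'] & state a2 (t ++ a :: s).
  move=> x y p ax a2y n1 n2; have p' : perm_eq [:: y; x] [:: z; z'].
    by rewrite (perm_catC [:: y] [:: x]).
  exists [:: y; x] => //; apply: state_join => //; first exact: u p'.
  by rewrite /= andbT [col y x]colC [col x a]colC ![_ == col x y]eq_sym n2 eq_sym n1.
have [e|n1] := eqVneq (col a z) (col z z').
  apply: (h z' z) => //; first by rewrite (perm_catC [:: z'] [:: z]).
    rewrite [col z' z]colC -e; apply: contraNneq nz => /(star_inj E2 cE az' az) ->//.
  by rewrite [col z' z]colC -e; apply: col_swap; rewrite // eq_sym.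
have [e|n2] := eqVneq (col z z') (col a2 z'); last exact: (h z z').
apply: (h z' z) => //; first by rewrite (perm_catC [:: z'] [:: z]).
  by rewrite [col z' z]colC e; apply: col_swap; rewrite // eq_sym.
rewrite [col z' z]colC e; apply: contraNneq nz => /(star_inj E2 cE a2z' a2z) ->//.
Qed.

Lemma two_fresh Q s : size s + 2 <= #|Q| ->
  exists z z', [/\ z \in Q, z' \in Q, z \notin s, z' \notin s & z != z'].
Proof.
move=> h; have := card_avoid Q s.
set S := [set x in Q | _] => hS; have : 1 < #|S| by move: h hS; clear; lia.
case/card_gt1P=> z [z' []]; rewrite !inE => /andP[zQ zs] /andP[z'Q z's] nz.
by exists z, z'.
Qed.

Lemma fill Q a s (R : seq V) : complete_to Q -> state a s -> a \in A ->
    {subset R <= A} -> uniq R -> {in R, forall b, b \notin a :: s} ->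
    l + 2 <= #|Q| ->
  exists a' s', [/\ a' \in A, state a' s', size s' = size s + 3 * size R
    & forall x, x \in a' :: s' -> [|| x \in a :: s, x \in Q | x \in R]].
Proof.
move=> AQ; elim: R a s => [|b R IH] a s sas aA RA uR Rs lQ.
  by exists a, s; rewrite muln0 addn0; split=> // x ->.
case/andP: uR => bR uR.
have bA : b \in A by apply: RA; rewrite inE eqxx.
have [us ps _] := sas; have lt := nopath us ps; rewrite /= in lt.
have [|z [z' [zQ z'Q zs z's nz]]] := @two_fresh Q s.
  by move: lt lQ; clear; lia.
have [|t pt sb] := link_pair sas (AQ _ _ aA zQ) (AQ _ _ aA z'Q) (AQ _ _ bA zQ)
  (AQ _ _ bA z'Q) nz _ zs z's; first by apply: Rs; rewrite inE eqxx.
have tQ x : x \in t -> x \in Q.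
  by rewrite (perm_mem pt) !inE => /orP[]/eqP->.
have [||//|a' [s' [a'A sa' sz' sub]]] := IH _ _ sb bA _ uR.
- by move=> x xR; apply: RA; rewrite inE xR orbT.
- move=> x xR; rewrite inE negb_or (memPn bR) //= mem_cat negb_or.
  rewrite Rs ?inE ?xR ?orbT // andbT; apply/negP=> /tQ xQ.
  have := complete_to_disjoint AQ xQ.
  by rewrite RA // inE xR orbT.
exists a', s'; split=> //.
  by rewrite sz' size_cat (perm_size pt) /=; clear; lia.
move=> x /sub /or3P[|->|xR]; rewrite ?orbT //; last by rewrite [x \in b :: R]inE xR !orbT.
rewrite [x \in b :: _]inE mem_cat => /or3P[/eqP->|/tQ->|->]; rewrite ?inE ?eqxx ?orbT //.
Qed.

Lemma start_pair Q a s : complete_to Q -> a \in A -> size s + 2 <= #|Q| ->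
  exists t, [/\ size t = 2, state a t, {subset t <= Q} & {in t, forall x, x \notin s}].
Proof.
move=> AQ aA hQ; have [z [z' [zQ z'Q zs z's nz]]] := two_fresh hQ.
have az := AQ _ _ aA zQ; have az' := AQ _ _ aA z'Q.
case/orP: (pair_start az az' nz) => n1.
  exists [:: z; z']; split=> // [|x|x]; last 2 first.
  - by rewrite !inE => /orP[]/eqP->.
  - by rewrite !inE => /orP[]/eqP->.
  split=> //; last by rewrite pc_cons3 n1.
  by rewrite /= !inE !negb_or nz (adj_neq E2 az) (adj_neq E2 az').
exists [:: z'; z]; split=> // [|x|x]; last 2 first.
- by rewrite !inE => /orP[]/eqP->.
- by rewrite !inE => /orP[]/eqP->.
split=> //; last by rewrite pc_cons3 [col z' z]colC n1.
by rewrite /= !inE !negb_or [z' == z]eq_sym nz (adj_neq E2 az) (adj_neq E2 az').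
Qed.

Lemma end_pair Q a s : complete_to Q -> a \in A -> state a s -> l + 2 <= #|Q| ->
  size s + 3 < l.
Proof.
move=> AQ aA sas hQ; have [us ps _] := sas; have lt := nopath us ps.
have [|z [z' [zQ z'Q zs z's nz]]] := @two_fresh Q s.
  by move: lt hQ; clear; rewrite /=; lia.
have az := AQ _ _ aA zQ; have az' := AQ _ _ aA z'Q.
have h x y : adj a x -> adj a y -> x != y -> x \notin s -> y \notin s ->
    col a x != col x y -> size s + 3 < l.
  move=> ax ay nxy xs ys n1; have [ux px] := state_cons E2 cE sas ax xs.
  suff: size [:: y, x, a & s] < l by rewrite /=; clear; lia.
  apply: nopath.
    by rewrite cons_uniq ux andbT !inE !negb_or eq_sym nxy ys eq_sym (adj_neq E2 ay).
  by rewrite pc_cons3 px andbT eq_sym colC [col y x]colC.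
case/orP: (pair_start az az' nz) => n1; first exact: (h z z').
by apply: (h z' z) => //; [rewrite eq_sym | rewrite [col z' z]colC].
Qed.

(* A colour clash at an end of the cherry involves a single vertex of [A]. *)
Lemma cherry_obstruction Z t : complete_to Z -> uniq t -> pc t -> size t = 3 ->
    {subset t <= Z} ->
  exists p, forall a s a2, state a s -> a \in A -> a2 \in A -> a2 \notin a :: s ->
    a != p -> a2 != p -> {in t, forall x, x \notin s} ->
    exists2 t', perm_eq t' t & state a2 (t' ++ a :: s).
Proof.
case: t => [|z1 [|z2 [|z3 [|]]]] // AZ ut pt _ tZ.
have [z1Z z2Z z3Z] : [/\ z1 \in Z, z2 \in Z & z3 \in Z].
  by split; apply: tZ; rewrite !inE eqxx ?orbT.
have n12 : col z1 z2 != col z2 z3 by case/andP: pt.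
(* At most one vertex of [A] sends colour [col z1 z2] to [z1]; it is taken as [p]. If there is none,
   [z1] serves as a dummy. *)
have [p hp] : exists p, {in A, forall a, a != p -> col a z1 != col z1 z2}.
  case: (pickP [pred a in A | col a z1 == col z1 z2]) => [p /andP[pA /eqP e]|no].
    exists p => a aA; rewrite -e => nap.
    by apply: col_swap => //; apply: AZ.
  by exists z1 => a aA _; have := no a; rewrite /= aA /= => ->.
exists p => a s a2 sas aA a2A na2 ap a2p ts.
have [us _ _] := sas.
have na : a2 != a by move: na2; rewrite inE negb_or => /andP[].
have u t : perm_eq t [:: z1; z2; z3] -> uniq (a2 :: t ++ a :: s).
  move=> pt'; have dA x : x \in A -> x \notin t.
    move=> xA; apply/negP; rewrite (perm_mem pt') => /tZ.
    by move/(complete_to_disjoint AZ); rewrite xA.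
  rewrite cons_uniq mem_cat negb_or na2 dA //=.
  rewrite cat_uniq (perm_uniq pt') ut us andbT.
  apply/hasPn=> x; rewrite inE => /orP[/eqP->|xs]; first exact: dA.
  by apply: contraL xs; rewrite /= (perm_mem pt'); apply: ts.
(* A clash between [a] and the end [z3] is removed by reversing the cherry, because [a2] then sends
   another colour to [z3]. *)
have [e|n3] := eqVneq (col a z3) (col z2 z3).
  exists [:: z3; z2; z1]; first by rewrite (perm_rev [:: z1; z2; z3]).
  apply: state_join => //=; try exact: AZ; last first.
    have k1 : col a2 z3 != col z2 z3 by rewrite -e; apply: col_swap => //; apply: AZ.
    have k2 : col z2 z3 != col z1 z2 by rewrite eq_sym.
    have k3 : col z1 z2 != col a z1 by rewrite eq_sym hp.
    by rewrite [col z3 z2]colC [col z2 z1]colC [col z1 a]colC k1 k2 k3.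
  by apply: (u [:: z3; z2; z1]); rewrite (perm_rev [:: z1; z2; z3]).
exists [:: z1; z2; z3] => //.
apply: state_join => //=; try exact: AZ; last first.
  by rewrite andbT hp //= n12 [col z3 a]colC eq_sym.
exact: (u [:: z1; z2; z3]).
Qed.

(** Seven vertices in [A] leave four that avoid the three obstructions; the cherries go between
    them. Pairs fill the other gaps and both ends: [#|A|] vertices of [A], nine of cherries and
    [2 * (#|A| - 4) + 4] of pairs, [3 * #|A| + 5] in all. *)
Lemma three_cherries Z t1 t2 t3 : complete_to Z ->
    uniq (t1 ++ t2 ++ t3) -> {subset t1 ++ t2 ++ t3 <= Z} ->
    pc t1 -> pc t2 -> pc t3 -> size t1 = 3 -> size t2 = 3 -> size t3 = 3 ->
    7 <= #|A| -> l + 11 <= #|Z| ->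
  3 * #|A| + 5 < l.
Proof.
move=> AZ ut tZ p1 p2 p3 s1 s2 s3 A7 lZ.
have [t1Z t2Z t3Z] : [/\ {subset t1 <= Z}, {subset t2 <= Z} & {subset t3 <= Z}].
  by split=> x xt; apply: tZ; rewrite !mem_cat xt ?orbT.
move: (ut); rewrite !cat_uniq has_cat negb_or.
case/and3P=> u1 /andP[d12 d13] /and3P[u2 d23 u3].
have [q1 h1] := cherry_obstruction AZ u1 p1 s1 t1Z.
have [q2 h2] := cherry_obstruction AZ u2 p2 s2 t2Z.
have [q3 h3] := cherry_obstruction AZ u3 p3 s3 t3Z.
have [e se [ue eA]] : exists2 e, size e = 4 &
    uniq e /\ {subset e <= [set x in A | x \notin [:: q1; q2; q3]]}.
  set S := [set x in A | _].
  have : 4 <= #|S|.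
    by have := card_avoid A [:: q1; q2; q3]; rewrite -/S; move: A7; clear; rewrite /=; lia.
  move=> S4; exists (take 4 (enum S)); first by rewrite size_takel // -cardE.
  by split=> [|x /mem_take]; rewrite ?take_uniq ?enum_uniq // mem_enum.
case: e se ue eA => [|b1 [|b2 [|b3 [|b4 [|]]]]] // _ ue eA.
have eAq b : b \in [:: b1; b2; b3; b4] -> [/\ b \in A, b != q1, b != q2 & b != q3].
  by move/eA; rewrite !inE !negb_or => /and4P[].
have [b1A b11 b12 b13] : [/\ b1 \in A, b1 != q1, b1 != q2 & b1 != q3].
  by apply: eAq; rewrite !inE eqxx.
have [b2A b21 b22 b23] : [/\ b2 \in A, b2 != q1, b2 != q2 & b2 != q3].
  by apply: eAq; rewrite !inE eqxx orbT.
have [b3A b31 b32 b33] : [/\ b3 \in A, b3 != q1, b3 != q2 & b3 != q3].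
  by apply: eAq; rewrite !inE eqxx !orbT.
have [b4A b41 b42 b43] : [/\ b4 \in A, b4 != q1, b4 != q2 & b4 != q3].
  by apply: eAq; rewrite !inE eqxx !orbT.
move: ue; rewrite /= !inE !negb_or -!andbA => /and5P[n12 n13 n14 n23 /and3P[n24 n34 _]].
have dA t x : {subset t <= Z} -> x \in A -> x \notin t.
  by move=> tZ' xA; apply/negP=> /tZ' /(complete_to_disjoint AZ); rewrite xA.
have [|t0 [st0 sb1 t0Z t0f]] := start_pair (s := t1 ++ t2 ++ t3) AZ b1A.
  by rewrite !size_cat s1 s2 s3; move: lZ; clear; lia.
have t0d x : x \in t0 -> [/\ x \notin t1, x \notin t2 & x \notin t3].
  by move/t0f; rewrite !mem_cat !negb_or => /and3P[].
have [|x xt|t1' pt1 sb2] := h1 b1 t0 b2 sb1 b1A b2A _ b11 b21.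
- by rewrite inE negb_or eq_sym n12 dA.
- by apply/negP=> /t0d[]; rewrite xt.
have t1'Z : {subset t1' <= Z} by move=> x; rewrite (perm_mem pt1) => /t1Z.
have [|x xt|t2' pt2 sb3] := h2 b2 _ b3 sb2 b2A b3A _ b22 b32.
- rewrite inE negb_or eq_sym n23 mem_cat inE !negb_or.
  by rewrite [b3 == b1]eq_sym n13 !dA.
- rewrite mem_cat inE !negb_or (perm_mem pt1); apply/and3P; split.
  + by apply: contra d12 => x1; apply/hasP; exists x.
  + apply: contraTneq (t2Z _ xt) => ->; apply: contraL b1A.
    by move/(complete_to_disjoint AZ).
  + by apply/negP=> /t0d[_]; rewrite xt.
have t2'Z : {subset t2' <= Z} by move=> x; rewrite (perm_mem pt2) => /t2Z.
have [|x xt|t3' pt3 sb4] := h3 b3 _ b4 sb3 b3A b4A _ b33 b43.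
- rewrite inE negb_or eq_sym n34 mem_cat inE mem_cat inE !negb_or.
  by rewrite [b4 == b2]eq_sym n24 [b4 == b1]eq_sym n14 !dA.
- have xA : x \notin A by apply: complete_to_disjoint AZ _; apply: t3Z.
  rewrite mem_cat inE mem_cat inE !negb_or (perm_mem pt1) (perm_mem pt2).
  rewrite (memPnC xA) // (memPnC xA) //=; apply/and3P; split.
  + by apply: contra d23 => x1; apply/hasP; exists x.
  + by apply: contra d13 => x1; apply/hasP; exists x.
  + by apply/negP=> /t0d[_ _]; rewrite xt.
have t3'Z : {subset t3' <= Z} by move=> x; rewrite (perm_mem pt3) => /t3Z.
pose R := enum [set x in A | x \notin [:: b1; b2; b3; b4]].
have szR : #|A| <= size R + 4 by rewrite -cardE; apply: card_avoid.
have [||||a' [s' [a'A sa' sz' _]]] := fill (R := R) AZ sb4 b4A.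
- by move=> x; rewrite mem_enum !inE => /andP[].
- exact: enum_uniq.
- move=> x; rewrite mem_enum !inE !negb_or => /and5P[xA nx1 nx2 nx3 nx4].
  rewrite nx4 !(mem_cat, inE) !negb_or nx1 nx2 nx3 /=.
  by rewrite (dA t3') // (dA t2') // (dA t1') // (dA t0).
- by move: lZ; clear; lia.
have : size s' + 3 < l by apply: end_pair AZ a'A sa' _; move: lZ; clear; lia.
rewrite sz' size_cat /= size_cat /= size_cat /= st0.
rewrite (perm_size pt1) (perm_size pt2) (perm_size pt3) s1 s2 s3.
by move: szR; clear; lia.
Qed.

(** Without a cherry, edges sharing a vertex have equal colours, and any two edges of a complete
    graph are joined by such steps. *)
Lemma cherry_or_mono Z :
  (exists t, [/\ uniq t, pc t, size t = 3 & {subset t <= Z}]) \/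
  exists b, {in Z &, forall u v, u != v -> col u v = b}.
Proof.
case: (boolP [exists x in Z, exists y in Z, exists z in Z,
    uniq [:: x; y; z] && pc [:: x; y; z]]) => [|no].
  case/exists_inP=> x xZ /exists_inP[y yZ /exists_inP[z zZ /andP[u p]]].
  left; exists [:: x; y; z]; split=> // w.
  by rewrite !inE => /or3P[]/eqP->.
have nc x y z : x \in Z -> y \in Z -> z \in Z -> uniq [:: x; y; z] ->
    col x y = col y z.
  move=> xZ yZ zZ u; apply/eqP; apply: contraNT no => n.
  apply/exists_inP; exists x => //; apply/exists_inP; exists y => //.
  by apply/exists_inP; exists z; rewrite // u /= n.
right; have [|] := ltnP 1 #|Z|; last first.
  (* With at most one vertex in [Z] the claim is vacuous, and [c set0] is a dummy colour. *)
  move=> Z1; exists (c set0) => u v uZ vZ nuv; move: Z1; rewrite leqNgt => /negP[].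
  by apply/card_gt1P; exists u, v.
case/card_gt1P=> u0 [v0 [u0Z v0Z n0]]; exists (col u0 v0).
have h v : v \in Z -> v != u0 -> col v u0 = col u0 v0.
  move=> vZ nv; have [->|nv0] := eqVneq v v0; first by rewrite colC.
  by apply: nc => //; rewrite /= !inE negb_or nv nv0 n0.
move=> u v uZ vZ nuv; have [e|nu] := eqVneq u u0.
  by rewrite e colC h // -e eq_sym.
have [->|nv] := eqVneq v u0; first exact: h.
rewrite (nc u v u0) ?h //= !inE negb_or nuv nu nv //.
Qed.

(** Disjoint cherries are removed greedily; by [three_cherries] there are at most two, which
    accounts for the 6 vertices lost. *)
Lemma mono_core Z : complete_to Z -> 7 <= #|A| -> l <= 3 * #|A| + 5 ->
    l + 11 <= #|Z| ->
  exists b (Y : {set V}), [/\ Y \subset Z, #|Z| <= #|Y| + 6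
    & {in Y &, forall u v, u != v -> col u v = b}].
Proof.
move=> AZ A7 lA lZ.
have sub (S : {set V}) t : [set x in S | x \notin t] \subset S.
  by apply/subsetP=> x; rewrite inE => /andP[].
have [[t1 [u1 p1 s1 t1Z]]|[b mono]] := cherry_or_mono Z; last first.
  by exists b, Z; rewrite leq_addr.
have c1 := card_avoid Z t1.
pose Z1 := [set x in Z | x \notin t1].
have [[t2 [u2 p2 s2 t2Z]]|[b mono]] := cherry_or_mono Z1; last first.
  by exists b, Z1; rewrite sub; split=> //; move: c1; rewrite s1 -/Z1; clear; lia.
have c2 := card_avoid Z1 t2.
pose Z2 := [set x in Z1 | x \notin t2].
have [[t3 [u3 p3 s3 t3Z]]|[b mono]] := cherry_or_mono Z2; last first.
  exists b, Z2; rewrite (subset_trans (sub _ _) (sub _ _)); split=> //.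
  by move: c1 c2; rewrite s1 s2 -/Z1 -/Z2; clear; lia.
have h1 x : x \in Z1 -> x \in Z /\ x \notin t1 by rewrite inE => /andP.
have h2 x : x \in Z2 -> x \in Z1 /\ x \notin t2 by rewrite inE => /andP.
have : 3 * #|A| + 5 < l; last by rewrite ltnNge lA.
apply: (three_cherries (t1 := t1) (t2 := t2) (t3 := t3) AZ) => //.
  rewrite !cat_uniq u1 u2 u3 has_cat negb_or andbT /=.
  apply/andP; split; first (apply/andP; split).
  - by apply/hasPn=> x /t2Z/h1[].
  - by apply/hasPn=> x /t3Z/h2[/h1[]].
  - by apply/hasPn=> x /t3Z/h2[].
move=> x; rewrite !mem_cat => /or3P[/t1Z//|/t2Z/h1[]//|/t3Z/h2[/h1[]]//].
Qed.

End CommonNeighbours.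

(** * Paths assembled from segments on a monochromatic core *)

Section Segments.
Variables (V C : finType) (c : {set V} -> C) (l : nat).
Hypothesis nopath : forall s : seq V, uniq s -> pc c s -> size s < l.
Variable E : {set {set V}}.
Hypotheses (E2 : forall e, e \in E -> #|e| = 2) (cE : {in E &, injective c}).
Variables (A Q : {set V}) (b : C).
Hypothesis AQ : complete_to E A Q.
Hypothesis Qb : {in Q &, forall u v, u != v -> col c u v = b}.
Hypothesis AQb : {in A & Q, forall a q, col c a q != b}.

Local Notation col := (col c).
Local Notation pc := (pc c).
Local Notation adj := (adj E).
Local Notation state := (state c E).
Implicit Types (a x y z w : V) (s t : seq V).

(* As [A] sends no colour [b] to [Q], a segment can be entered from any vertex
   of [A]. *)
Definition seg t := [/\ pc t, {in t, forall x, x \notin A}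
  & if t is q :: v :: _ then (q \in Q) && (col q v == b) else false].

Lemma seg_state a t : seg t -> uniq t -> a \in A -> state a t.
Proof.
case: t => [|q [|v t]] [pt tA h] // ut aA; case/andP: h => qQ /eqP qv.
split; last exact: AQ.
  rewrite cons_uniq ut andbT; apply: contraL aA; exact: tA.
by rewrite pc_cons3 pt andbT qv; apply: AQb.
Qed.

Lemma seg_join a s t : state a s -> a \in A -> seg (rev t) ->
  uniq (t ++ a :: s) -> pc (t ++ a :: s).
Proof.
move=> sas aA st u; have ut : uniq (rev t).
  by move: u; rewrite rev_uniq cat_uniq => /andP[].
have [_ pa ax] := seg_state st ut aA.
apply: (state_link E2 cE sas u).
- by rewrite -pc_rev rev_rcons.
- move: ax st; rewrite -{3}[t]revK; case: (rev t) => [|x t'] /=.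
    by move=> _ [].
  by rewrite rev_cons last_rcons.
Qed.

(* Path: [t0], a vertex of [A], [t1], then pairs from [Q] between the remaining
   vertices of [A], and finally [t2]. *)
Lemma assemble t0 t1 t2 : seg t0 -> seg t1 -> seg (rev t1) -> seg t2 ->
    uniq (t0 ++ t1 ++ t2) -> 1 < #|A| -> l + 2 + size t2 <= #|Q| ->
  size t0 + size t1 + size t2 + 3 * #|A| < l + 4.
Proof.
move=> g0 g1 g1r g2 u A2 lQ.
move: (u); rewrite !cat_uniq has_cat negb_or.
case/and3P=> u0 /andP[d01 d02] /and3P[u1 d12 u2].
have [a1 [a2 [a1A a2A na]]] := card_gt1P A2.
have dis t x : seg t -> x \in A -> x \notin t.
  by case=> _ tA _ xA; apply: contraL xA; apply: tA.
have st1 := seg_state g0 u0 a1A.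
have ua : uniq (t1 ++ a1 :: t0).
  rewrite cat_uniq u1 cons_uniq u0 (dis t0) //= andbT negb_or dis //=.
  by rewrite has_sym.
have ua2 : uniq (a2 :: t1 ++ a1 :: t0).
  rewrite cons_uniq ua andbT mem_cat inE !negb_or (dis t1) // (dis t0) //.
  by rewrite eq_sym na.
have st2 : state a2 (t1 ++ a1 :: t0).
  split=> //.
    have := seg_join st1 a1A g1r ua.
    case: t1 g1 {g1r u d01 u1 d12 ua ua2} => [|q [|v t]] [_ _ h] // p.
    case/andP: h => qQ /eqP qv.
    by rewrite cat_cons pc_cons3 p andbT qv; apply: AQb.
  case: t1 g1 {g1r u d01 u1 d12 ua ua2} => [|q [|v t]] [_ _ h] //.
  by case/andP: h => qQ _; apply: AQ.
pose R := enum [set x in A | x \notin [:: a1; a2]].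
have szR : #|A| <= size R + 2 by rewrite -cardE; apply: card_avoid.
pose Q' := [set x in Q | x \notin t2].
have cQ : #|Q| <= #|Q'| + size t2 by apply: card_avoid.
have AQ' : complete_to E A Q'.
  by move=> a q aA; rewrite inE => /andP[qQ _]; apply: AQ.
have [||||a' [s' [a'A sa' sz' sub]]] := fill nopath E2 cE (R := R) AQ' st2 a2A.
- by move=> x; rewrite mem_enum !inE => /andP[].
- exact: enum_uniq.
- move=> x; rewrite mem_enum in_set !inE !negb_or => /and3P[xA nx1 nx2].
  by rewrite nx2 mem_cat inE !negb_or nx1 (dis t1) // (dis t0).
- by move: cQ lQ; clear; lia.
have us' : uniq (rev t2 ++ a' :: s').
  have [us' _ _] := sa'; rewrite cat_uniq rev_uniq u2 us' andbT.
  apply/hasPn=> x /sub xs; rewrite /= mem_rev; case/or3P: xs => [|xQ|].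
  - rewrite inE mem_cat inE => /or3P[/eqP->|x1|/orP[/eqP->|x0]].
    + exact: dis.
    + by apply: contra d12 => xt; apply/hasP; exists x.
    + exact: dis.
    + by apply: contra d02 => xt; apply/hasP; exists x.
  - by move: xQ; rewrite inE => /andP[].
  - by rewrite mem_enum inE => /andP[xA _]; apply: dis.
(* Besides the three segments the path has two vertices of [A] and three for each of the other
   [#|A| - 2]; this gives the 4 in the bound. *)
have := nopath us' (seg_join sa' a'A _ us'); rewrite revK => /(_ g2).
rewrite size_cat size_rev /= sz' size_cat /=.
by move: szR; clear; lia.
Qed.

(** Two different colours other than [b], towards [q1] and [q2], would make [p, q1, x, q2, p'] a
    middle segment, three vertices longer than a pair. *)
Lemma two_colors x : x \notin A -> x \notin Q -> l <= 3 * #|A| + 5 -> 1 < #|A| ->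
    l + 10 <= #|Q| ->
  exists d, {in Q, forall q, col x q = b \/ col x q = d}.
Proof.
move=> xA xQ lA A2 lQ.
case: (pickP [pred q in Q | col x q != b]) => [q1 /andP[/= q1Q n1]|no]; last first.
  by exists b => q qQ; left; apply/eqP; have := no q; rewrite /= qQ; case: eqP.
exists (col x q1) => q2 q2Q; have [e|n2] := eqVneq (col x q2) b; first by left.
right; apply/eqP; apply: contraLR lA => n12; rewrite -ltnNge.
have nq : q1 != q2 by apply: contraNneq n12 => ->.
have [e se [ue eQ]] : exists2 e, size e = 6 &
    uniq e /\ {subset e <= [set z in Q | z \notin [:: q1; q2]]}.
  set S := [set z in Q | _].
  have S6 : 6 <= #|S|.
    by have := card_avoid Q [:: q1; q2]; rewrite -/S; move: lQ; clear; rewrite /=; lia.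
  exists (take 6 (enum S)); first by rewrite size_takel // -cardE.
  by split=> [|z /mem_take]; rewrite ?take_uniq ?enum_uniq // mem_enum.
have {}eQ z : z \in e -> [/\ z \in Q, z != q1, z != q2 & z != x].
  move/eQ; rewrite !inE negb_or => /and3P[zQ -> ->]; rewrite zQ; split=> //.
  by apply: contraNneq xQ => <-.
have QA z : z \in Q -> z \notin A by exact: (complete_to_disjoint E2 AQ).
case: e se ue eQ => [|p [|p' [|p1 [|p2 [|p3 [|p4 [|]]]]]]] // _ ue eQ.
have [[pQ np1 np2 npx] [p'Q np'1 np'2 np'x]] :
    [/\ p \in Q, p != q1, p != q2 & p != x] /\
    [/\ p' \in Q, p' != q1, p' != q2 & p' != x].
  by split; apply: eQ; rewrite !inE eqxx ?orbT.
have s2 z z' : z \in [:: p; p'; p1; p2; p3; p4] -> z' \in [:: p; p'; p1; p2; p3; p4] ->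
    z != z' -> seg [:: z; z'].
  move=> /eQ[zQ _ _ _] /eQ[z'Q _ _ _] nz; split=> //; last by rewrite zQ Qb //=.
  by move=> w; rewrite !inE => /orP[]/eqP->; apply: QA.
have s5 z z' y y' : z \in Q -> z' \in Q -> y \in Q -> y' \in Q -> z != y -> y' != z' ->
    col x y != b -> col x y' != b -> col x y' != col x y -> seg [:: z; y; x; y'; z'].
  move=> zQ z'Q yQ y'Q n3 n4 n5 n6 n7; split; last by rewrite zQ Qb //=.
    rewrite /= (Qb zQ yQ n3) (Qb y'Q z'Q n4) [col y x]colC [b == _]eq_sym n5.
    by rewrite [_ == col x y']eq_sym n7 n6.
  by move=> w; rewrite !inE => /or4P[/eqP->|/eqP->|/eqP->|/orP[]/eqP->] //; apply: QA.
have nx z : z \in Q -> x != z by move=> zQ; apply: contraNneq xQ => ->.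
have := @assemble [:: p1; p2] [:: p; q1; x; q2; p'] [:: p3; p4].
move: (ue); rewrite /= !inE !negb_or -!andbA.
case/and5P=> n01 n02 n03 n04 /and5P[n05 n22 n13 n14 /and5P[n15 n23 n24 n25
  /and4P[n34 n35 n45 _]]].
move=> /(_ (s2 _ _ _ _ _) (s5 _ _ _ _ _ _ _ _ _ _ _ _ _)
  (s5 _ _ _ _ _ _ _ _ _ _ _ _ _) (s2 _ _ _ _ _)) h.
have {}h : 2 + 5 + 2 + 3 * #|A| < l + 4; last by move: h; clear; lia.
apply: h => //; rewrite ?inE ?eqxx ?orbT //; try by rewrite eq_sym.
  have [p1Q ? ? ?] : [/\ p1 \in Q, p1 != q1, p1 != q2 & p1 != x].
    by apply: eQ; rewrite !inE eqxx ?orbT.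
  have [p2Q ? ? ?] : [/\ p2 \in Q, p2 != q1, p2 != q2 & p2 != x].
    by apply: eQ; rewrite !inE eqxx ?orbT.
  have [p3Q ? ? ?] : [/\ p3 \in Q, p3 != q1, p3 != q2 & p3 != x].
    by apply: eQ; rewrite !inE eqxx ?orbT.
  have [p4Q ? ? ?] : [/\ p4 \in Q, p4 != q1, p4 != q2 & p4 != x].
    by apply: eQ; rewrite !inE eqxx ?orbT.
  by repeat (apply/andP; split); rewrite ?nx //; rewrite eq_sym // nx.
by move: lQ; clear; lia.
Qed.

(** Each [x] splits the current set into two colour classes, and the larger is kept. *)
Lemma uniform_subset (X : seq V) (S : {set V}) :
    {in X, forall x, exists d, {in S, forall q, col x q = b \/ col x q = d}} ->
  exists S' : {set V}, [/\ S' \subset S, #|S| <= 2 ^ size X * #|S'|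
    & {in X, forall x, exists d, {in S', forall q, col x q = d}}].
Proof.
elim: X S => [|x X IH] S h; first by exists S; rewrite mul1n.
have [d hd] := h x (mem_head _ _).
have [S' [sS cS uS]] : exists S' : {set V}, [/\ S' \subset S, #|S| <= 2 * #|S'|
    & exists d, {in S', forall q, col x q = d}].
  pose S1 := [set q in S | col x q == b]; pose S2 := [set q in S | col x q == d].
  have c12 : #|S| <= #|S1| + #|S2|.
    apply: leq_trans (leq_card_setU _ _); apply/subset_leq_card/subsetP=> q qS.
    by rewrite !inE qS; case: (hd q qS) => ->; rewrite eqxx ?orbT.
  have [l12|l21] := leqP #|S1| #|S2|.
    exists S2; split; first by apply/subsetP=> q; rewrite inE => /andP[].
      by move: c12 l12; clear; lia.
    by exists d => q; rewrite inE => /andP[_ /eqP].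
  exists S1; split; first by apply/subsetP=> q; rewrite inE => /andP[].
    by move: c12 l21; clear; lia.
  by exists b => q; rewrite inE => /andP[_ /eqP].
have [|S'' [sS' cS' uS']] := IH S'.
  move=> y yX; have [|d' hd'] := h y; first by rewrite inE yX orbT.
  by exists d' => q /(subsetP sS); apply: hd'.
exists S''; split; first exact: subset_trans sS' sS.
  by rewrite /= expnS -mulnA; apply: leq_trans cS _; rewrite leq_mul2l.
move=> y; rewrite inE => /orP[/eqP->|/uS'//].
by case: uS => d' hd'; exists d' => q /(subsetP sS'); apply: hd'.
Qed.

(** * Gains from outside vertices joined to the core in one colour *)

Section Uniform.
Hypotheses (A2 : 1 < #|A|) (lQ : l + 8 <= #|Q|).

Definition unif x d :=
  [/\ x \notin A, x \notin Q & {in Q, forall q, col x q = d}].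

Variable q : nat -> V.
Hypotheses (qQ : forall i, i < 8 -> q i \in Q)
  (qE : forall i j, i < 8 -> j < 8 -> (q i == q j) = (i == j)).

Lemma qb i j : i < 8 -> j < 8 -> i != j -> col (q i) (q j) = b.
Proof. by move=> i8 j8 nij; apply: Qb; rewrite ?qQ // qE. Qed.

Lemma qA i : i < 8 -> q i \notin A.
Proof. by move=> i8; exact: (complete_to_disjoint E2 AQ (qQ i8)). Qed.

Lemma unif_q x d i : unif x d -> i < 8 ->
  [/\ col x (q i) = d, col (q i) x = d, (x == q i) = false & (q i == x) = false].
Proof.
case=> _ xQ xd i8; have n : x != q i by apply: contraNneq xQ => ->; apply: qQ.
by rewrite [col (q i) x]colC xd ?qQ // [q i == x]eq_sym (negPf n).
Qed.

Lemma unif_neq x d y d' : unif x d -> unif y d' -> d != d' -> x != y.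
Proof.
move=> ux uy; apply: contraNneq => exy.
have [<- _ _ _] := unif_q ux (isT : 0 < 8).
by have [<- _ _ _] := unif_q uy (isT : 0 < 8); rewrite exy.
Qed.

(* With three segments [q i; q j], [assemble] gives [3 * #|A| + 2 < l].  The lemmas
   [gain1], [gain2] and [gain3] improve this by the corresponding number of
   vertices, replacing pairs by longer segments. *)
Lemma seg_q i j : i < 8 -> j < 8 -> i != j -> seg [:: q i; q j].
Proof.
move=> i8 j8 nij; split=> //; last by rewrite qQ //= qb.
by move=> x; rewrite !inE => /orP[]/eqP->; apply: qA.
Qed.

Lemma seg_qqu i j u d : i < 8 -> j < 8 -> i != j -> unif u d -> d != b ->
  seg [:: q i; q j; u].
Proof.
move=> i8 j8 nij uu db; have [_ e _ _] := unif_q uu j8.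
split; last by rewrite qQ //= qb.
  by rewrite /= qb // e eq_sym db.
by move=> x; rewrite !inE => /or3P[]/eqP->; rewrite ?qA //; case: uu.
Qed.

Lemma seg_qxyq i j x y : i < 8 -> j < 8 -> unif x b -> unif y b -> col x y != b ->
  seg [:: q i; x; y; q j].
Proof.
move=> i8 j8 ux uy n; have [_ ex _ _] := unif_q ux i8.
have [ey _ _ _] := unif_q uy j8.
split; last by rewrite qQ //= ex.
  by rewrite /= ex ey n eq_sym n.
by move=> z; rewrite !inE => /or4P[]/eqP->; rewrite ?qA //; [case: ux | case: uy].
Qed.

Lemma seg_qxy i x y : i < 8 -> unif x b -> y \notin A -> col x y != b ->
  seg [:: q i; x; y].
Proof.
move=> i8 ux yA n; have [_ ex _ _] := unif_q ux i8.
split; last by rewrite qQ //= ex.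
  by rewrite /= ex eq_sym n.
by move=> z; rewrite !inE => /or3P[]/eqP->; rewrite ?qA //; case: ux.
Qed.

(** The middle segment [q 0, x, y, q 1, q 2] has colours [b], [col x y], [d], [b]. *)
Lemma mixed_edge x y d : unif x b -> unif y d -> x != y -> col x y != b ->
  d != b -> d != col x y -> 3 * #|A| + 5 < l.
Proof.
move=> ux uy nxy nb db dc.
have [ex0' ex0 _ _] := unif_q ux (isT : 0 < 8).
have [ey1 ey1' _ _] := unif_q uy (isT : 1 < 8).
have uA x' d' : unif x' d' -> x' \notin A by case.
have := @assemble [:: q 3; q 4] [:: q 0; x; y; q 1; q 2] [:: q 5; q 6].
move=> /(_ (seg_q _ _ _) _ _ (seg_q _ _ _)) h.
have {}h : 2 + 5 + 2 + 3 * #|A| < l + 4; last by move: h; clear; lia.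
apply: h => //.
- split; last by rewrite qQ //= ex0.
    by rewrite /= ex0 ey1 qb // [b == _]eq_sym nb [col x y == _]eq_sym dc db.
  by move=> z; rewrite !inE => /or4P[/eqP->|/eqP->|/eqP->|/orP[]/eqP->];
    rewrite ?qA ?(uA _ _ ux) ?(uA _ _ uy).
- rewrite /rev /=; split; last by rewrite qQ //= qb.
    by rewrite /= [col y x]colC ex0' ey1' qb // [b == _]eq_sym db dc nb.
  by move=> z; rewrite !inE => /or4P[/eqP->|/eqP->|/eqP->|/orP[]/eqP->];
    rewrite ?qA ?(uA _ _ ux) ?(uA _ _ uy).
- have xq i : i < 8 -> (x == q i) = false by case/(unif_q ux).
  have qx i : i < 8 -> (q i == x) = false by case/(unif_q ux).
  have yq i : i < 8 -> (y == q i) = false by case/(unif_q uy).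
  have qy i : i < 8 -> (q i == y) = false by case/(unif_q uy).
  by rewrite /= !inE !qE // ?xq // ?qx // ?yq // ?qy // (negPf nxy).
- by move: lQ; clear; rewrite /=; lia.
Qed.

(** The middle segment [q 0, q 1, x, y, q 2, q 3] has colours [b], [d], [col x y], [d'], [b]. *)
Lemma outer_edge x y d d' : unif x d -> unif y d' -> x != y -> d != b ->
  d' != b -> d != col x y -> d' != col x y -> 3 * #|A| + 5 < l.
Proof.
move=> ux uy nxy db db' dc dc'.
have [ex ex' _ _] := unif_q ux (isT : 1 < 8).
have [ey ey' _ _] := unif_q uy (isT : 2 < 8).
have uA x' e : unif x' e -> x' \notin A by case.
have := @assemble [:: q 4; q 5] [:: q 0; q 1; x; y; q 2; q 3] [:: q 6; q 7].
move=> /(_ (seg_q _ _ _) _ _ (seg_q _ _ _)) h.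
have {}h : 2 + 6 + 2 + 3 * #|A| < l + 4; last by move: h; clear; lia.
apply: h => //.
- split; last by rewrite qQ //= qb.
    by rewrite /= ex' ey !qb // [b == _]eq_sym db dc [col x y == _]eq_sym dc' db'.
  by move=> z; rewrite !inE => /or4P[/eqP->|/eqP->|/eqP->|/or3P[]/eqP->];
    rewrite ?qA ?(uA _ _ ux) ?(uA _ _ uy).
- rewrite /rev /=; split; last by rewrite qQ //= qb.
    rewrite /= [col y x]colC ex ey' !qb // [b == _]eq_sym db' dc'.
    by rewrite [col x y == _]eq_sym dc db.
  by move=> z; rewrite !inE => /or4P[/eqP->|/eqP->|/eqP->|/or3P[]/eqP->];
    rewrite ?qA ?(uA _ _ ux) ?(uA _ _ uy).
- have xq i : i < 8 -> (x == q i) = false by case/(unif_q ux).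
  have qx i : i < 8 -> (q i == x) = false by case/(unif_q ux).
  have yq i : i < 8 -> (y == q i) = false by case/(unif_q uy).
  have qy i : i < 8 -> (q i == y) = false by case/(unif_q uy).
  by rewrite /= !inE !qE // ?xq // ?qx // ?yq // ?qy // (negPf nxy).
- by move: lQ; clear; rewrite /=; lia.
Qed.

(** If neither end is uniform in [col x y], then [mixed_edge] or [outer_edge] gives too long a path
    unless both ends are uniform in [b]. *)
Lemma edge_outcome x y d d' : l <= 3 * #|A| + 5 ->
    unif x d -> unif y d' -> x != y -> col x y != b ->
  (unif x b /\ unif y b) \/ (exists2 u, u \in [:: x; y] & unif u (col x y)).
Proof.
move=> lA ux uy nxy nb.
have [ed|nd] := eqVneq d (col x y).
  by right; exists x; rewrite ?inE ?eqxx // -ed.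
have [ed'|nd'] := eqVneq d' (col x y).
  by right; exists y; rewrite ?inE ?eqxx ?orbT // -ed'.
have [e|n] := eqVneq d b; have [e'|n'] := eqVneq d' b.
- by left; rewrite -{1}e -e'.
- by have := mixed_edge (x := x) _ uy nxy nb n' nd'; rewrite -{1}e ltnNge lA => /(_ ux).
- have := mixed_edge (x := y) _ ux; rewrite eq_sym colC -{1}e'.
  by move=> /(_ uy nxy nb n nd); rewrite ltnNge lA.
- by have := outer_edge ux uy nxy n n' nd nd'; rewrite ltnNge lA.
Qed.

(** In the names, [u] stands for a vertex uniform in a colour other than [b], and [B] for one
    uniform in [b]. A [u] can prolong the first or last segment; a [B]-[B] edge not coloured [b] can
    sit inside the middle one. *)
Lemma gain1_u u d : unif u d -> d != b -> 3 * #|A| + 3 < l.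
Proof.
move=> uu db; have uq i : i < 8 -> (u == q i) = false by case/(unif_q uu).
have qu i : i < 8 -> (q i == u) = false by case/(unif_q uu).
have := @assemble [:: q 0; q 1; u] [:: q 2; q 3] [:: q 4; q 5].
move=> /(_ (seg_qqu _ _ _ uu db) (seg_q _ _ _) (seg_q _ _ _) (seg_q _ _ _)) h.
have {}h : 3 + 2 + 2 + 3 * #|A| < l + 4; last by move: h; clear; lia.
apply: h => //; first by rewrite /= !inE !qE // ?uq // ?qu //.
by move: lQ; clear; rewrite /=; lia.
Qed.

Lemma gain2_BB x y : unif x b -> unif y b -> x != y -> col x y != b ->
  3 * #|A| + 4 < l.
Proof.
move=> ux uy nxy nb.
have xq i : i < 8 -> (x == q i) = false by case/(unif_q ux).
have qx i : i < 8 -> (q i == x) = false by case/(unif_q ux).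
have yq i : i < 8 -> (y == q i) = false by case/(unif_q uy).
have qy i : i < 8 -> (q i == y) = false by case/(unif_q uy).
have := @assemble [:: q 2; q 3] [:: q 0; x; y; q 1] [:: q 4; q 5].
have nb' : col y x != b by rewrite colC.
move=> /(_ (seg_q _ _ _) (seg_qxyq _ _ ux uy nb) (seg_qxyq _ _ uy ux nb')
  (seg_q _ _ _)) h.
have {}h : 2 + 4 + 2 + 3 * #|A| < l + 4; last by move: h; clear; lia.
apply: h => //; first by rewrite /= !inE !qE // ?xq // ?qx // ?yq // ?qy // (negPf nxy).
by move: lQ; clear; rewrite /=; lia.
Qed.

Lemma gain2_uu u v d d' : unif u d -> unif v d' -> d != b -> d' != b -> d != d' ->
  3 * #|A| + 4 < l.
Proof.
move=> ux uy db db' dd; have nxy := unif_neq ux uy dd.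
have xq i : i < 8 -> (u == q i) = false by case/(unif_q ux).
have qx i : i < 8 -> (q i == u) = false by case/(unif_q ux).
have yq i : i < 8 -> (v == q i) = false by case/(unif_q uy).
have qy i : i < 8 -> (q i == v) = false by case/(unif_q uy).
have := @assemble [:: q 0; q 1; u] [:: q 2; q 3] [:: q 4; q 5; v].
move=> /(_ (seg_qqu _ _ _ ux db) (seg_q _ _ _) (seg_q _ _ _) (seg_qqu _ _ _ uy db')) h.
have {}h : 3 + 2 + 3 + 3 * #|A| < l + 4; last by move: h; clear; lia.
apply: h => //; first by rewrite /= !inE !qE // ?xq // ?qx // ?yq // ?qy // (negPf nxy).
by move: lQ; clear; rewrite /=; lia.
Qed.

Lemma gain3_uuu u v w d d' d'' : unif u d -> unif v d' -> unif w d'' ->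
    d != b -> d' != b -> d'' != b -> d != d' -> d != d'' -> d' != d'' ->
    col u v != d ->
  3 * #|A| + 5 < l.
Proof.
move=> ux uy uw db db' db'' dd dd' dd'' nuv; have nxy := unif_neq ux uy dd.
have nuw := unif_neq ux uw dd'; have nvw := unif_neq uy uw dd''.
have xq i : i < 8 -> (u == q i) = false by case/(unif_q ux).
have qx i : i < 8 -> (q i == u) = false by case/(unif_q ux).
have yq i : i < 8 -> (v == q i) = false by case/(unif_q uy).
have qy i : i < 8 -> (q i == v) = false by case/(unif_q uy).
have wq i : i < 8 -> (w == q i) = false by case/(unif_q uw).
have qw i : i < 8 -> (q i == w) = false by case/(unif_q uw).
have := @assemble [:: q 0; q 1; u; v] [:: q 2; q 3] [:: q 4; q 5; w].
move=> /(_ _ (seg_q _ _ _) (seg_q _ _ _) (seg_qqu _ _ _ uw db'')) h.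
have {}h : 4 + 2 + 3 + 3 * #|A| < l + 4; last by move: h; clear; lia.
apply: h => //.
- split; last by rewrite qQ //= qb.
    have [_ e _ _] := unif_q ux (isT : 1 < 8).
    by rewrite /= e qb // eq_sym db eq_sym nuv.
  move=> z; rewrite !inE => /or4P[]/eqP->; rewrite ?qA //; [by case: ux | by case: uy].
- rewrite /= !inE !qE // ?xq // ?qx // ?yq // ?qy // ?qw //.
  by rewrite (negPf nxy) (negPf nuw) (negPf nvw).
by move: lQ; clear; rewrite /=; lia.
Qed.

Lemma gain3_BBu x y u d : unif x b -> unif y b -> unif u d ->
    x != y -> col x y != b -> d != b ->
  3 * #|A| + 5 < l.
Proof.
move=> ux uy uw nxy nb db.
have nux : u != x by apply: unif_neq uw ux db.
have nuy : u != y by apply: unif_neq uw uy db.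
have xq i : i < 8 -> (x == q i) = false by case/(unif_q ux).
have qx i : i < 8 -> (q i == x) = false by case/(unif_q ux).
have yq i : i < 8 -> (y == q i) = false by case/(unif_q uy).
have qy i : i < 8 -> (q i == y) = false by case/(unif_q uy).
have wq i : i < 8 -> (u == q i) = false by case/(unif_q uw).
have qw i : i < 8 -> (q i == u) = false by case/(unif_q uw).
have := @assemble [:: q 2; q 3; u] [:: q 0; x; y; q 1] [:: q 4; q 5].
have nb' : col y x != b by rewrite colC.
move=> /(_ (seg_qqu _ _ _ uw db) (seg_qxyq _ _ ux uy nb) (seg_qxyq _ _ uy ux nb')
  (seg_q _ _ _)) h.
have {}h : 3 + 4 + 2 + 3 * #|A| < l + 4; last by move: h; clear; lia.
apply: h => //.
  rewrite /= !inE !qE // ?xq // ?qx // ?yq // ?qy // ?wq // ?qw //.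
  by rewrite (negPf nxy) (negPf nux) (negPf nuy).
by move: lQ; clear; rewrite /=; lia.
Qed.

Lemma gain3_BBBB x y x' y' : unif x b -> unif y b -> unif x' b -> unif y' b ->
    uniq [:: x; y; x'; y'] -> col x y != b -> col x' y' != b ->
  3 * #|A| + 5 < l.
Proof.
move=> ux uy uw uv u4 nb nb1.
have xq i : i < 8 -> (x == q i) = false by case/(unif_q ux).
have qx i : i < 8 -> (q i == x) = false by case/(unif_q ux).
have yq i : i < 8 -> (y == q i) = false by case/(unif_q uy).
have qy i : i < 8 -> (q i == y) = false by case/(unif_q uy).
have wq i : i < 8 -> (x' == q i) = false by case/(unif_q uw).
have qw i : i < 8 -> (q i == x') = false by case/(unif_q uw).
have vq i : i < 8 -> (y' == q i) = false by case/(unif_q uv).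
have qv i : i < 8 -> (q i == y') = false by case/(unif_q uv).
have := @assemble [:: q 2; q 3] [:: q 0; x; y; q 1] [:: q 4; x'; y'].
have nb' : col y x != b by rewrite colC.
have y'A : y' \notin A by case: uv.
move=> /(_ (seg_q _ _ _) (seg_qxyq _ _ ux uy nb) (seg_qxyq _ _ uy ux nb')
  (seg_qxy _ uw y'A nb1)) h.
have {}h : 2 + 4 + 3 + 3 * #|A| < l + 4; last by move: h; clear; lia.
apply: h => //.
  rewrite /= !inE !qE // ?xq // ?qx // ?yq // ?qy // ?wq // ?qw // ?vq // ?qv //.
  by move: u4; rewrite /= !inE ?orbF.
by move: lQ; clear; rewrite /=; lia.
Qed.

Lemma gain3_BBB x y y' : unif x b -> unif y b -> unif y' b ->
    uniq [:: y; x; y'] -> col x y != b -> col x y' != b -> col x y != col x y' ->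
  3 * #|A| + 5 < l.
Proof.
move=> ux uy uw u3 nb nb1 ne.
have xq i : i < 8 -> (x == q i) = false by case/(unif_q ux).
have qx i : i < 8 -> (q i == x) = false by case/(unif_q ux).
have yq i : i < 8 -> (y == q i) = false by case/(unif_q uy).
have qy i : i < 8 -> (q i == y) = false by case/(unif_q uy).
have wq i : i < 8 -> (y' == q i) = false by case/(unif_q uw).
have qw i : i < 8 -> (q i == y') = false by case/(unif_q uw).
have s5 i j z z' : i < 8 -> j < 8 -> unif z b -> unif z' b -> col x z != b ->
    col x z' != b -> col x z != col x z' -> seg [:: q i; z; x; z'; q j].
  move=> i8 j8 uz uz' n1 n2 n3; have [_ e _ _] := unif_q uz i8.
  have [e' _ _ _] := unif_q uz' j8.
  split; last by rewrite qQ //= e.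
    by rewrite /= e e' [col z x]colC n2 n3 eq_sym n1.
  move=> w; rewrite !inE => /or4P[/eqP->|/eqP->|/eqP->|/orP[]/eqP->];
    rewrite ?qA //; [by case: uz | by case: ux | by case: uz'].
have := @assemble [:: q 2; q 3] [:: q 0; y; x; y'; q 1] [:: q 4; q 5].
have ne' : col x y' != col x y by rewrite eq_sym.
move=> /(_ (seg_q _ _ _) (s5 _ _ _ _ _ _ uy uw nb nb1 ne)
  (s5 _ _ _ _ _ _ uw uy nb1 nb ne') (seg_q _ _ _)) h.
have {}h : 2 + 5 + 2 + 3 * #|A| < l + 4; last by move: h; clear; lia.
apply: h => //.
  by rewrite /= !inE !qE // ?xq // ?qx // ?yq // ?qy // ?wq // ?qw //.
by move: lQ; clear; rewrite /=; lia.
Qed.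

Definition extra_edge (e : {set V}) := c e != b /\
  exists x y d d', [/\ e = [set x; y], x != y, unif x d & unif y d'].

Lemma extra_edge_outcome e : l <= 3 * #|A| + 5 -> extra_edge e ->
  (exists x y, [/\ e = [set x; y], x != y, unif x b & unif y b]) \/
  (exists u, unif u (c e)).
Proof.
move=> lA [nb [x [y [d [d' [ee nxy ux uy]]]]]].
rewrite ee in nb *.
have [[ux' uy']|[u _ uu]] := edge_outcome lA ux uy nxy nb.
  by left; exists x, y.
by right; exists u.
Qed.

Lemma gain1 e : l <= 3 * #|A| + 5 -> extra_edge e -> 3 * #|A| + 3 < l.
Proof.
move=> lA xe; have [nb _] := xe.
have [[x [y [ee nxy ux uy]]]|[u uu]] := extra_edge_outcome lA xe.
  rewrite ee in nb; have := gain2_BB ux uy nxy nb; clear; lia.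
exact: gain1_u uu nb.
Qed.

Lemma gain2 e e' : l <= 3 * #|A| + 5 -> extra_edge e -> extra_edge e' ->
  c e != c e' -> 3 * #|A| + 4 < l.
Proof.
move=> lA xe xe' ne; have [nb _] := xe; have [nb' _] := xe'.
have [[x [y [ee nxy ux uy]]]|[u uu]] := extra_edge_outcome lA xe.
  by rewrite ee in nb; exact: gain2_BB ux uy nxy nb.
have [[x [y [ee nxy ux uy]]]|[u' uu']] := extra_edge_outcome lA xe'.
  by rewrite ee in nb'; exact: gain2_BB ux uy nxy nb'.
exact: gain2_uu uu uu' nb nb' ne.
Qed.

(** If [e] supplies a [u], it prolongs an end. Otherwise [e] joins two vertices uniform in [b]:
    sharing an end with [x y] it yields a middle segment of five vertices, and disjoint from [x y]
    it ends the path. *)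
Lemma gain3_BB x y e : l <= 3 * #|A| + 5 -> extra_edge e -> x != y ->
    unif x b -> unif y b -> col x y != b -> c e != col x y ->
  3 * #|A| + 5 < l.
Proof.
move=> lA xe nxy ux uy nb ne; have [nb' _] := xe.
have [[x' [y' [ee nxy' ux' uy']]]|[u uu]] := extra_edge_outcome lA xe; last first.
  exact: gain3_BBu ux uy uu nxy nb nb'.
rewrite ee in nb' ne.
have share z z' w w' : unif z b -> unif z' b -> unif w b -> unif w' b ->
    z != z' -> w != w' -> col z z' != b -> col w w' != b -> col w w' != col z z' ->
    z = w -> 3 * #|A| + 5 < l.
  move=> uz uz' uw uw' n1 n2 n3 n4 n5 ezw; rewrite -{}ezw in uw n2 n4 n5.
  apply: (gain3_BBB uz uz' uw') => //; last by rewrite eq_sym.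
  rewrite /= !inE negb_or eq_sym n1 n2 !andbT; apply: contraNneq n5 => ->//.
have nyx : y != x by rewrite eq_sym.
have nyx' : y' != x' by rewrite eq_sym.
have [e1|n1] := eqVneq x x'; first exact: (share x y x' y').
have [e2|n2] := eqVneq x y'.
  by apply: (share x y y' x'); rewrite // colC.
have [e3|n3] := eqVneq y x'.
  by apply: (share y x x' y'); rewrite // (colC c y x).
have [e4|n4] := eqVneq y y'.
  by apply: (share y x y' x'); rewrite // ?(colC c y x) // (colC c y' x').
apply: (gain3_BBBB ux uy ux' uy') => //.
by rewrite /= !inE !negb_or nxy n1 n2 n3 n4 nxy'.
Qed.

Lemma gain3 e1 e2 e3 : l <= 3 * #|A| + 5 ->
    extra_edge e1 -> extra_edge e2 -> extra_edge e3 ->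
    c e1 != c e2 -> c e1 != c e3 -> c e2 != c e3 ->
  3 * #|A| + 5 < l.
Proof.
move=> lA x1 x2 x3 n12 n13 n23.
have [b1 _] := x1; have [b2 _] := x2; have [b3 _] := x3.
have [[x [y [ee nxy ux uy]]]|[u uu]] := extra_edge_outcome lA x1.
  by rewrite ee in b1 n12; apply: (gain3_BB lA x2 nxy ux uy b1); rewrite eq_sym.
have [[x [y [ee nxy ux uy]]]|[v uv]] := extra_edge_outcome lA x2.
  by rewrite ee in b2 n12; apply: (gain3_BB lA x1 nxy ux uy b2).
have [[x [y [ee nxy ux uy]]]|[w uw]] := extra_edge_outcome lA x3.
  by rewrite ee in b3 n13; apply: (gain3_BB lA x1 nxy ux uy b3).
(* [col u v] differs from [c e1] or from [c e2]; the matching one of [u], [v] comes first in the end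
   segment. *)
have [e|n] := eqVneq (col u v) (c e1).
  apply: (gain3_uuu uv uu uw) => //; first by rewrite eq_sym.
  by rewrite colC e.
exact: (gain3_uuu uu uv uw).
Qed.

End Uniform.

End Segments.

(** * The upper bound *)

Lemma bin2_double m : 2 * 'C(m, 2) + m = m * m.
Proof.
by rewrite -[2 in X in X * _]/(1.+1) mul_bin_left bin1; case: m => // m; lia.
Qed.

Section Extremal.
Variables (V C : finType) (c : {set V} -> C) (l : nat).
Hypothesis nopath : forall s : seq V, uniq s -> pc c s -> size s < l.
Variable E : {set {set V}}.
Hypotheses (E2 : forall e, e \in E -> #|e| = 2) (cE : {in E &, injective c}).

Local Notation col := (col c).
Local Notation pc := (pc c).
Local Notation adj := (adj E).
Local Notation nbr := (nbr E).

(** At most one edge of [E] has colour [b], and it has at most one end in [Z] when its other end is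
    in [A]. *)
Lemma few_star_colors (A Z : {set V}) (b : C) : complete_to E A Z ->
  #|[set z in Z | [exists a in A, col a z == b]]| <= 1.
Proof.
move=> AZ; rewrite leqNgt; apply/negP=> /card_gt1P[z [z' []]].
rewrite !inE => /andP[zZ /exists_inP[a aA /eqP e]].
case/andP=> z'Z /exists_inP[a' a'A /eqP e'] /eqP[].
have /cE ee : c [set a; z] = c [set a'; z'] by rewrite [LHS]e -[RHS]/(col a' z') e'.
have : z \in [set a'; z'] by rewrite -ee ?inE ?eqxx ?orbT //; apply: AZ.
rewrite !inE => /orP[/eqP eza|/eqP//].
by have := complete_to_disjoint E2 AZ zZ; rewrite eza a'A.
Qed.

(** With [r + 2] edges avoiding [A], at least [r + 1] are not coloured [b]; they gain [r + 1]
    vertices. The size of [Z] pays for 6 vertices lost to the core, one to colour [b] towards [A], 6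
    ends of extra edges, and a factor [64 = 2 ^ 6] for making these ends uniform. *)
Lemma few_extra_edges (A Z : {set V}) (F : {set {set V}}) r :
    complete_to E A Z -> 7 <= #|A| -> r < 3 -> l = 3 * #|A| + 3 + r ->
    F \subset E -> {in F, forall e : {set V}, [disjoint e & A]} ->
    64 * (l + 8) + 13 <= #|Z| ->
  #|F| <= r.+1.
Proof.
move=> AZ A7 r3 lA FE FA lZ; rewrite leqNgt; apply/negP=> Fr.
have lA5 : l <= 3 * #|A| + 5 by move: lA r3; clear; lia.
have [|b [Y [YZ cY Yb]]] := mono_core nopath E2 cE AZ A7 lA5.
  by move: lZ; clear; lia.
pose F1 := [set e in F | c e != b].
have cF1 : r.+1 <= #|F1|.
  have : #|[set e in F | c e == b]| <= 1.
    rewrite leqNgt; apply/negP=> /card_gt1P[e [e' []]].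
    rewrite !inE => /andP[eF /eqP eb] /andP[e'F /eqP eb'] /eqP[].
    by apply: cE; rewrite ?(subsetP FE) // eb eb'.
  have : F \subset [set e in F | c e == b] :|: F1.
    by apply/subsetP=> e eF; rewrite !inE eF orbN.
  move/subset_leq_card => h1 h2; have := leq_trans h1 (leq_card_setU _ _).
  by move: h2 Fr; clear; lia.
have [es se [ues esF]] : exists2 es, size es = r.+1 & uniq es /\ {subset es <= F1}.
  exists (take r.+1 (enum F1)); first by rewrite size_takel // -cardE.
  by split=> [|x /mem_take]; rewrite ?take_uniq ?enum_uniq // mem_enum.
have esE e : e \in es -> [/\ e \in E, [disjoint e & A] & c e != b].
  by move/esF; rewrite inE => /andP[eF ->]; rewrite (subsetP FE) // FA.
pose X := flatten [seq enum (mem e) | e : {set V} <- es].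
have memX e x : e \in es -> x \in e -> x \in X.
  by move=> ees xe; apply/flatten_mapP; exists e; rewrite // mem_enum.
have XA x : x \in X -> x \notin A.
  case/flatten_mapP=> e /esE[_ dA _]; rewrite mem_enum => xe.
  by rewrite (disjointFr dA).
have szX : size X <= 6.
  have -> : size X = \sum_(e <- es) 2.
    rewrite size_flatten /shape -map_comp sumnE big_map.
    apply: eq_big_seq => e /esE[eE _ _].
    by rewrite /= -cardE E2.
  by rewrite big_const_seq count_predT se iter_addn; move: r3; clear; lia.
(* Removing [Bad] ensures that [A] sends no colour [b] to the core, as segments require. *)
pose Bad := [set z in Y | [exists a in A, col a z == b]].
pose Y1 := [set y in Y | y \notin enum Bad ++ X].
have AY : complete_to E A Y.
  by move=> a y aA yY; apply: AZ => //; apply: (subsetP YZ).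
have cBad : size (enum Bad) <= 1 by rewrite -cardE; apply: few_star_colors.
have cY1 : #|Y| <= #|Y1| + 7.
  have := card_avoid Y (enum Bad ++ X); rewrite size_cat -/Y1.
  by move: cBad szX; clear; lia.
have Y1P y : y \in Y1 -> [/\ y \in Y, y \notin Bad & y \notin X].
  by rewrite inE mem_cat negb_or mem_enum => /and3P[].
have AY1 : complete_to E A Y1 by move=> a y aA /Y1P[yY _ _]; apply: AY.
have Y1b : {in Y1 &, forall u v, u != v -> col u v = b}.
  by move=> u v /Y1P[uY _ _] /Y1P[vY _ _]; apply: Yb.
have AY1b : {in A & Y1, forall a q, col a q != b}.
  move=> a y aA /Y1P[yY nB _]; apply: contra nB => ab.
  by rewrite inE yY; apply/exists_inP; exists a.
have XY1 x : x \in X -> x \notin Y1 by apply: contraTN => /Y1P[].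
have A2 : 1 < #|A| by move: A7; clear; lia.
have [x xX|Q [QY1 cQ uQ]] := uniform_subset (c := c) (b := b) (X := X) (S := Y1).
  apply: (two_colors nopath E2 cE AY1 Y1b AY1b (XA _ xX) (XY1 _ xX) lA5 A2).
  by move: cY1 cY lZ; clear; lia.
have lQ : l + 8 <= #|Q|.
  have h : #|Y1| <= 64 * #|Q|.
    apply: leq_trans cQ _; rewrite leq_mul2r; apply/orP; right.
    by rewrite -[64]/(2 ^ 6) leq_exp2l.
  by move: h cY1 cY lZ; clear; lia.
have AQ : complete_to E A Q by move=> a y aA /(subsetP QY1); apply: AY1.
have Qb : {in Q &, forall u v, u != v -> col u v = b}.
  by move=> u v /(subsetP QY1) uQ' /(subsetP QY1); apply: Y1b.
have AQb : {in A & Q, forall a q, col a q != b}.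
  by move=> a y aA /(subsetP QY1); apply: AY1b.
have xX e : e \in es -> extra_edge c A Q b e.
  move=> ees; have [eE _ nb] := esE e ees; split=> //.
  have /eqP/cards2P[x [y [nxy ee]]] := E2 eE.
  have [xX yX] : x \in X /\ y \in X.
    by split; apply: (memX e) => //; rewrite ee !inE eqxx ?orbT.
  have [d hd] := uQ x xX; have [d' hd'] := uQ y yX.
  have nQ z : z \in X -> z \notin Q.
    by move=> zX; apply: contra (XY1 _ zX); apply: (subsetP QY1).
  by exists x, y, d, d'; split=> //; split=> //; [apply: XA | apply: nQ | apply: XA | apply: nQ].
have [q0 _] : exists q, q \in Q by apply/card_gt0P; move: lQ; clear; lia.
pose q i := nth q0 (enum Q) i.
have sQ i : i < 8 -> i < size (enum Q) by rewrite -cardE; move: lQ; clear; lia.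
have qQ i : i < 8 -> q i \in Q by move=> i8; rewrite -mem_enum mem_nth ?sQ.
have qE i j : i < 8 -> j < 8 -> (q i == q j) = (i == j).
  by move=> i8 j8; rewrite nth_uniq ?sQ ?enum_uniq.
have {ues}ces : uniq (map c es).
  by rewrite map_inj_in_uniq // => e e' /esE[eE _ _] /esE[e'E _ _]; apply: cE.
clear -nopath E2 cE AQ Qb AQb A2 lQ qQ qE lA5 lA r3 se xX ces.
case: r r3 lA se => [|[|[|//]]] _ lA se.
- case: es se xX ces => [//|e [|? ? //]] _ xX _.
  have := gain1 nopath E2 cE AQ Qb AQb A2 lQ qQ qE lA5 (xX e (mem_head _ _)).
  by move: lA; clear; lia.
- case: es se xX ces => [//|e [//|e' [|? ? //]]] _ xX.
  rewrite /= inE andbT => n1.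
  have [m1 m2] : e \in [:: e; e'] /\ e' \in [:: e; e'] by rewrite !inE !eqxx orbT.
  have := gain2 nopath E2 cE AQ Qb AQb A2 lQ qQ qE lA5 (xX e m1) (xX e' m2) n1.
  by move: lA; clear; lia.
- case: es se xX ces => [//|e [//|e' [//|e'' [|? ? //]]]] _ xX.
  rewrite /= !inE negb_or -!andbA => /and4P[n1 n2 n3 _].
  have [m1 m2 m3] : [/\ e \in [:: e; e'; e''], e' \in [:: e; e'; e'']
                      & e'' \in [:: e; e'; e'']].
    by rewrite !inE !eqxx ?orbT.
  have := gain3 nopath E2 cE AQ Qb AQb A2 lQ qQ qE lA5 (xX e m1) (xX e' m2) (xX e'' m3).
  by move=> /(_ n1 n2 n3); move: lA; clear; lia.
Qed.

Lemma card_bigcup_leq (I T : finType) (S : {set I}) (B : I -> {set T}) :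
  #|\bigcup_(i in S) B i| <= \sum_(i in S) #|B i|.
Proof.
elim/big_rec2: _ => [|i m U _ IH]; first by rewrite cards0.
by apply: leq_trans (leq_card_setU _ _) _; rewrite leq_add2l.
Qed.

Lemma edge_at (e : {set V}) v : e \in E -> v \in e ->
  exists2 u, e = [set v; u] & adj v u.
Proof.
move=> eE ve; have /eqP/cards2P[x [y [nxy ee]]] := E2 eE.
move: ve; rewrite ee !inE => /orP[]/eqP->; first by exists y; rewrite // /adj -ee.
by exists x; rewrite /adj setUC // -ee.
Qed.

Lemma card_edges_meeting (S : {set V}) (m : nat) (F : {set {set V}}) :
    F \subset E -> {in F, forall e : {set V}, exists2 v, v \in e & v \in S} ->
    {in S, forall v, #|nbr v| <= m} ->
  #|F| <= #|S| * m.
Proof.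
move=> FE FS Sm.
have sF : F \subset \bigcup_(v in S) [set [set v; u] | u in nbr v].
  apply/subsetP=> e eF; have [v ve vS] := FS e eF; apply/bigcupP; exists v => //.
  have [u -> vu] := edge_at (subsetP FE _ eF) ve.
  by apply/imsetP; exists u; rewrite // inE.
apply: leq_trans (subset_leq_card sF) _; apply: leq_trans (card_bigcup_leq _ _) _.
rewrite -sum_nat_const; apply: leq_sum => v vS.
exact: leq_trans (leq_imset_card _ _) (Sm v vS).
Qed.

Lemma maximal_matching : exists F : {set {set V}},
  [/\ F \subset E, trivIset F & {in E, forall e : {set V}, ~~ [disjoint e & cover F]}].
Proof.
have [|F] := @maxset_exists _
  [pred F : {set {set V}} | (F \subset E) && trivIset F] set0.
  by rewrite /= sub0set; apply/trivIsetP=> B1 B2; rewrite inE.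
case/maxsetP=> /andP[/= FE tF] mF _; exists F; split=> // e eE.
apply/negP=> dis.
have F0 : set0 \notin F by apply/negP=> /(subsetP FE)/E2; rewrite cards0.
have dF : {in F, forall B : {set V}, [disjoint e & B]}.
  by move=> B BF; apply: disjointWr dis; apply: bigcup_sup.
have [t1 eF] := trivIsetU1 dF tF F0.
have eF' : e |: F = F.
  by apply: mF; rewrite ?subsetUr //= t1 subUset sub1set eE FE.
by move: eF; rewrite -eF' !inE eqxx.
Qed.

(** A vertex outside [A] contributes at most [#|A|] edges, and at least one fewer if it is not
    joined to all of [A]. *)
Lemma edges_on_set (A : {set V}) :
  #|[set e in E | ~~ [disjoint e & A]]| +
    #|[set v in ~: A | ~~ (A \subset nbr v)]| <= 'C(#|A|, 2) + #|A| * #|~: A|.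
Proof.
set F := [set e in E | _]; set U := [set v in ~: A | _].
pose AA := [set B : {set V} | B \subset A & #|B| == 2].
pose AW := \bigcup_(v in ~: A) [set [set v; u] | u in nbr v :&: A].
have sF : F \subset AA :|: AW.
  apply/subsetP=> e; rewrite [e \in F]inE => /andP[eE /pred0Pn[a /andP[/= ae aA]]].
  have [u ee au] := edge_at eE ae; rewrite in_setU inE E2 // eqxx andbT.
  have [uA|uA] := boolP (u \in A).
    by rewrite ee subUset !sub1set aA uA.
  apply/orP; right; apply/bigcupP; exists u; first by rewrite inE.
  apply/imsetP; exists a; last by rewrite ee setUC.
  by rewrite !inE aA adjC au.
have cAA : #|AA| = 'C(#|A|, 2) by rewrite /AA cards_draws.
have cAW : #|AW| + #|U| <= #|A| * #|~: A|.
  have -> : #|U| = \sum_(v in ~: A) ~~ (A \subset nbr v).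
    rewrite -sum1_card [LHS](eq_bigl [pred v | (v \in ~: A) && ~~ (A \subset nbr v)]).
      by rewrite big_mkcondr; apply: eq_bigr => v _; case: (A \subset _).
    by move=> v; rewrite !inE.
  apply: leq_trans (leq_add (card_bigcup_leq _ _) (leqnn _)) _.
  rewrite -big_split mulnC -sum_nat_const; apply: leq_sum => v _ /=.
  apply: leq_trans (leq_add (leq_imset_card _ _) (leqnn _)) _.
  have [sA|nA] := boolP (A \subset nbr v).
    by rewrite addn0 subset_leq_card // subsetIr.
  rewrite addn1; apply: proper_card; rewrite properE subsetIr subsetI subxx andbT //.
have h := leq_trans (subset_leq_card sF) (leq_card_setU _ _).
by apply: leq_trans (leq_add h (leqnn _)) _; rewrite -addnA cAA leq_add2l.
Qed.

(** The cubic bound on the number of vertices enters here: it absorbs the edges avoiding [A]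
    together with ['C(k, 2)]. *)
Lemma cubic_slack : 27 <= l -> l.-1 * l.-1 * (2 * l).-1 + l * l <= 2 * l ^ 3.
Proof.
clear; case: l => // m _; rewrite !expnS expn0 mulnS; cbn [predn]; nia.
Qed.

(** The summand [l] covers [#|A|]; the constants are the threshold on [#|Z|] in
    [few_extra_edges]. *)
Lemma common_neighbours_slack : 27 <= l ->
  l.-1 * l.-1 * (2 * l).-1 + l + 64 * (l + 8) + 13 <= 2 * l ^ 3.
Proof.
clear; case: l => // m m27; rewrite !expnS expn0 mulnS; cbn [predn]; nia.
Qed.

Lemma rainbow_edges_bound k r : 27 <= l -> r < 3 -> l = 3 * k + r ->
  2 * l ^ 3 <= #|V| -> #|E| <= (k - 1) * #|V| - 'C(k, 2) + 1 + r.
Proof.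
move=> l27 r3 lk hV.
have [F [FE tF mF]] := maximal_matching.
have cK : #|cover F| <= l.-1 * l.-1.
  apply: (rainbow_matching_bound nopath _ tF) => [e /(subsetP FE)/E2 //|].
  by move=> e e' /(subsetP FE) eE /(subsetP FE); apply: cE.
pose A := [set v | 2 * l <= #|nbr v|].
have cA : #|A| < k.
  apply: (big_vertices_bound nopath E2 cE).
  - by move=> v; rewrite inE.
  - by move: l27 r3 lk; clear; lia.
  - by move: l27 r3 lk; clear; lia.
  - by move: l27 r3 lk; clear; lia.
pose E1 := [set e in E | [disjoint e & A]].
pose EA := [set e in E | ~~ [disjoint e & A]].
have sE1 : E1 \subset E by apply/subsetP=> e; rewrite inE => /andP[].
have sEA : EA \subset E by apply/subsetP=> e; rewrite inE => /andP[].
have cE1A : #|E| <= #|E1| + #|EA|.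
  apply: leq_trans (leq_card_setU _ _); apply/subset_leq_card/subsetP=> e eE.
  by rewrite !inE eE orbN.
(* By maximality each edge avoiding [A] meets the matching in a vertex outside [A], whose degree is
   below [2 * l]. *)
have cE1 : #|E1| <= l.-1 * l.-1 * (2 * l).-1.
  apply: leq_trans (leq_mul cK (leqnn _)).
  apply: leq_trans (_ : #|cover F :\: A| * (2 * l).-1 <= _); last first.
    by rewrite leq_mul2r subset_leq_card ?subsetDl ?orbT.
  apply: (card_edges_meeting sE1) => [e|v]; rewrite inE; last first.
    by rewrite inE -ltnNge => /andP[nb _]; rewrite -ltnS (ltn_predK nb).
  case/andP=> eE dA; have /pred0Pn[v /andP[/= ve vK]] := mF e eE.
  by exists v; rewrite // inE vK andbT (disjointFr dA ve).
have ck : 'C(k, 2) <= l * l.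
  have := bin2 k; have := half_leq (leq_pred (k * k.-1)).
  by move: l27 r3 lk; clear; rewrite /=; nia.
have n0 : 2 * l ^ 3 = 2 * l * l * l by rewrite !expnS expn0; clear; lia.
(* With at most [k - 2] large vertices, the missing [#|V|] edges outweigh all edges avoiding [A]. *)
have [cA2|cA2] := leqP #|A| (k - 2).
  have cEA : #|EA| <= (k - 2) * #|V|.
    apply: leq_trans (leq_mul cA2 (leqnn _)).
    apply: (card_edges_meeting sEA) => [e|v _]; last exact: max_card.
    by rewrite inE => /andP[_ /pred0Pn[v /andP[ve vA]]]; exists v.
  have k2 : (k - 1) * #|V| = (k - 2) * #|V| + #|V|.
    by rewrite -mulSnr; congr (_ * _); move: l27 r3 lk; clear; lia.
  have h : #|E1| + 'C(k, 2) <= #|V|.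
    apply: leq_trans hV; apply: leq_trans (leq_add cE1 ck) _.
    exact: cubic_slack.
  by move: k2 h cEA cE1A; clear; lia.
have eA : #|A| = k - 1 by move: cA cA2; clear; lia.
pose U := [set v in ~: A | ~~ (A \subset nbr v)].
pose Z := [set v in ~: A | A \subset nbr v].
have AZ : complete_to E A Z.
  move=> a z aA; rewrite inE => /andP[_ /subsetP/(_ a aA)].
  by rewrite inE adjC.
have cZU : #|~: A| <= #|Z| + #|U|.
  apply: leq_trans (leq_card_setU _ _); apply/subset_leq_card/subsetP=> v vA.
  by rewrite in_setU [v \in Z]in_set [v \in U]in_set vA orbN.
have cC := cardsC A.
have cEA := edges_on_set A; rewrite -/EA -/U in cEA.
have idC : 'C(#|A|, 2) + #|A| * #|~: A| + 'C(k, 2) = (k - 1) * #|V|.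
  have -> : k = #|A|.+1 by move: eA l27 r3 lk; clear; lia.
  rewrite binS bin1 -cC subn1 /= mulnDr.
  suff: 'C(#|A|, 2) + ('C(#|A|, 2) + #|A|) = #|A| * #|A| by clear; lia.
  by rewrite addnA addnn -mul2n bin2_double.
have [few|many] := leqP #|E1| r.+1.
  by move: few idC cEA cE1A; clear; lia.
have [cZ|cZ] := leqP (64 * (l + 8) + 13) #|Z|.
  suff : #|E1| <= r.+1 by rewrite leqNgt many.
  apply: (few_extra_edges AZ _ r3 _ sE1 _ cZ); first by move: eA l27 r3 lk; clear; lia.
    by move: eA l27 r3 lk; clear; lia.
  by move=> e; rewrite inE => /andP[].
(* Few common neighbours mean many vertices in [U], each costing an edge at [A]; this compensates
   for all of [E1]. *)
have h : #|E1| <= #|U|.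
  apply: leq_trans cE1 _.
  have := common_neighbours_slack l27; move: cZ cZU cC eA hV lk; clear; lia.
by move: h idC cEA cE1A; clear; lia.
Qed.

End Extremal.

(** * Copies of paths *)

Section Paths.
Variables (n : nat) (C : finType) (c : {set complete_graph n} -> C).
Local Notation V := (complete_graph n : finType).

Lemma pc_nth (x0 : V) (s : seq V) i : pc c s -> i.+2 < size s ->
  col c (nth x0 s i) (nth x0 s i.+1) != col c (nth x0 s i.+1) (nth x0 s i.+2).
Proof.
elim: i s => [|i IH] [|x s] //= /andP[h ps] lt.
  by case: s h ps lt => [|y [|z s]].
exact: IH.
Qed.

Lemma nth_pc (x0 : V) (s : seq V) :
    (forall i, i.+2 < size s ->
      col c (nth x0 s i) (nth x0 s i.+1) != col c (nth x0 s i.+1) (nth x0 s i.+2)) ->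
  pc c s.
Proof.
elim: s => [|x s IH] // h; apply/andP; split; last by apply: IH => i; apply: (h i.+1).
by case: s IH h => [|y [|z s]] // _ h; apply: (h 0).
Qed.

Lemma mem_path_edges l (e : {set path_graph l}) : e \in edges (path_graph l) ->
  exists i j : 'I_l, j = i.+1 :> nat /\ e = [set i; j].
Proof.
case/imsetP=> -[i j]; rewrite inE /= => /orP[/eqP h ->|/eqP h ->].
  by exists i, j.
by exists j, i; rewrite setUC.
Qed.

Lemma complete_edges (e : {set V}) : (e \in edges (complete_graph n)) = (#|e| == 2).
Proof.
apply/imsetP/cards2P => [[[x y]]|[x [y [nxy ->]]]].
  by rewrite inE /= => nxy ->; exists x, y.
by exists (x, y); rewrite // inE.
Qed.

Lemma seq_pc_copy l (s : seq V) : uniq s -> pc c s -> size s = l -> 0 < l ->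
  has_pc_copy c (path_graph l).
Proof.
move=> us ps sz l0; have [x0 _] : exists x, x \in s.
  by case: s sz {us ps} => [sz|x s _]; [rewrite -sz in l0 | exists x; rewrite mem_head].
pose f : {ffun path_graph l -> V} := [ffun i : 'I_l => nth x0 s i].
have fE (i : 'I_l) : f i = nth x0 s i by rewrite ffunE.
have fI : injective f.
  move=> i j; rewrite !fE => /eqP; rewrite nth_uniq ?sz //= => /eqP h.
  exact: val_inj.
apply/existsP; exists f; apply/and3P; split.
- exact/injectiveP.
- apply/subsetP=> e /imsetP[e' /mem_path_edges[i [j [hj ->]]] ->].
  rewrite complete_edges card_imset // cards2.
  suff -> : i != j by [].
  by apply/eqP=> e1; move: hj; rewrite -e1; clear; lia.
have imf (i j : 'I_l) : f @: [set i; j] = [set f i; f j].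
  by rewrite imsetU1 imset_set1.
have step (i j j' : 'I_l) : j = i.+1 :> nat -> j' = j.+1 :> nat ->
    c [set f i; f j] != c [set f j; f j'].
  move=> hj hj'; rewrite !fE hj' hj.
  by apply: pc_nth; rewrite ?sz //; have := ltn_ord j'; rewrite hj' hj.
apply/forall_inP=> e1 /imsetP[_ /mem_path_edges[i [j [hj ->]]] ->].
apply/forall_inP=> e2 /imsetP[_ /mem_path_edges[i' [j' [hj' ->]]] ->].
apply/implyP=> /andP[ne /set0Pn[x]]; rewrite inE !imf in ne *; rewrite !inE => /andP[h h'].
have [ee|nii] := eqVneq i i'.
  have ejj : j = j' by apply: val_inj; rewrite /= hj hj' ee.
  by rewrite ee ejj eqxx in ne.
have {nii} nii : i != i' :> nat by [].
(* Distinct path edges cannot share both first or both second ends; the other two cases are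
   consecutive edges. *)
move: h h' => /orP[]/eqP-> /orP[]/eqP/fI h; move: nii.
- by rewrite h eqxx.
- by move=> _; rewrite eq_sym h; apply: step => //; rewrite -h.
- by move=> _; rewrite -h; apply: step => //; rewrite h.
- by move: hj; rewrite h hj' => -[->]; rewrite eqxx.
Qed.

Lemma pc_copy_seq l : has_pc_copy c (path_graph l) ->
  exists s : seq V, [/\ uniq s, pc c s & size s = l].
Proof.
case/existsP=> f /and3P[/injectiveP fI _ /forall_inP pf].
exists [seq f i | i <- enum 'I_l]; split.
- by rewrite map_inj_uniq ?enum_uniq.
- have [l0|l0] := posnP l.
    suff -> : enum 'I_l = [::] by [].
    by apply: size0nil; rewrite size_enum_ord.
  apply: (@nth_pc (f (Ordinal l0))) => m; rewrite size_map size_enum_ord => hi.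
  have n1 j (hj : j < l) :
      nth (f (Ordinal l0)) [seq f i | i <- enum 'I_l] j = f (Ordinal hj).
    rewrite (nth_map (Ordinal l0)) ?size_enum_ord //; congr (f _).
    by apply: val_inj; rewrite /= nth_enum_ord.
  have h2 : m.+1 < l by apply: ltnW.
  have h1 : m < l by apply: ltnW.
  rewrite (n1 m h1) (n1 m.+1 h2) (n1 m.+2 hi) /col.
  have imf (i j : 'I_l) : f @: [set i; j] = [set f i; f j].
    by rewrite imsetU1 imset_set1.
  have me (i j : 'I_l) : j = i.+1 :> nat -> [set f i; f j] \in copy_edges f.
    move=> hj; apply/imsetP; exists [set i; j]; last by rewrite imf.
    by apply/imsetP; exists (i, j); rewrite // inE /= /path_rel hj eqxx.
  have /forall_inP/(_ [set f (Ordinal h2); f (Ordinal hi)]) :=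
    pf _ (me (Ordinal h1) (Ordinal h2) erefl).
  move=> /(_ (me (Ordinal h2) (Ordinal hi) erefl)) /implyP; apply.
  apply/andP; split; last first.
    by apply/set0Pn; exists (f (Ordinal h2)); rewrite !inE !eqxx orbT.
  apply/eqP=> e; have : f (Ordinal h1) \in [set f (Ordinal h2); f (Ordinal hi)].
    by rewrite -e !inE eqxx.
  by rewrite !inE => /orP[]/eqP/fI/(congr1 val)/= h; move: h; clear; lia.
- by rewrite size_map size_enum_ord.
Qed.

End Paths.

(** * The lower bound *)

Section WeightedColoring.
Variables (V C : finType) (c : {set V} -> C) (A : {set V}) (w : V -> nat).
Hypothesis cw : forall x y z, uniq [:: x; y; z] -> x \notin A -> y \notin A ->
  z \notin A -> maxn (w x) (w y) = maxn (w y) (w z) -> col c x y = col c y z.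

(* Along a run avoiding [A] the weights strictly decrease, then possibly repeat
   once, then strictly increase; so each run has at most two weight-0 vertices. *)
Lemma zero_weight_count (s : seq V) : uniq s -> pc c s ->
  count [pred v | (v \notin A) && (w v == 0)] s <= 2 * count (mem A) s + 2.
Proof.
set Z := [pred v | _] => us ps.
(* [z] is the allowance for the run before the first vertex of [A]. When that run is a single vertex
   or starts by ascending, only its first vertex can have weight 0. *)
suff [z [z2 cz _]] : exists z, [/\ z <= 2, count Z s <= 2 * count (mem A) s + z
    & if s is x :: s' then
        if x \in A then z = 0 else
        if s' is y :: _ then
          (y \in A) || (w x < w y) -> z = (w x == 0)
        else z = (w x == 0)
      else True].
  by apply: leq_trans cz _; rewrite leq_add2l.
elim: s us ps => [|x s IH] us ps; first by exists 0.
have [|z [z2 cz hz]] := IH _ (pc_tail ps); first by case/andP: us.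
have [xA|xA] := boolP (x \in A).
  by exists 0; split=> //=; rewrite xA /=; move: cz z2; clear; lia.
have cx : count (mem A) (x :: s) = count (mem A) s by rewrite /= (negPf xA).
have cZ : count Z (x :: s) = (w x == 0) + count Z s by rewrite /= xA.
rewrite cx cZ; case: s us ps IH cz hz {cx cZ} => [|y s] us ps IH cz hz.
  by exists (w x == 0); split=> //; move: cz; rewrite /=; case: (w x == 0).
have [yA|yA] := boolP (y \in A).
  rewrite yA in hz; exists (w x == 0); split=> //; first by case: (w x == 0).
  by move: cz; rewrite hz; clear; lia.
rewrite (negPf yA) in hz.
have [hy|hy] := boolP (z == (w y == 0) :> nat).
  exists ((w x == 0) + (w y == 0)); split.
  - by case: (w x == 0); case: (w y == 0).
  - by move: cz; rewrite (eqP hy); clear; lia.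
  - by move=> /= lt; case: (w y) lt => //= m _; rewrite addn0.
case: s us ps hz hy cz {IH} => [|y' s] us ps hz hy cz.
  by rewrite hz eqxx in hy.
have y'A : y' \notin A by apply: contra hy => y'A; apply/eqP/hz; rewrite y'A.
have wy : w y' <= w y.
  by rewrite leqNgt; apply: contra hy => lt; apply/eqP/hz; rewrite lt orbT.
have wx : w y < w x.
  rewrite ltnNge; apply/negP=> le.
  have : col c x y = col c y y'.
    apply: cw => //; last by rewrite (maxn_idPr le) (maxn_idPl wy).
    by move: us; rewrite /= !inE !negb_or -!andbA => /and5P[-> -> _ -> _].
  by move: ps => /= /andP[/eqP].
exists z; split=> //.
  by move: cz wx; clear; case: (w x).
by rewrite /= => lt; move: wx lt; clear; lia.
Qed.

End WeightedColoring.

Lemma card_ord_below n m : m <= n -> #|[set v : 'I_n | v < m]| = m.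
Proof.
move=> mn; have -> : [set v : 'I_n | v < m] = [set widen_ord mn i | i : 'I_m].
  apply/setP=> v; rewrite inE; apply/idP/imsetP => [vm|[i _ ->]]; last exact: (ltn_ord i).
  by exists (Ordinal vm) => //; apply: val_inj.
by rewrite card_imset ?card_ord // => i j /(congr1 val) /= h; apply: val_inj.
Qed.

Section LowerBound.
Variables (n k r : nat).
Hypotheses (k0 : 0 < k) (r3 : r < 3) (kn : k + r + 1 <= n).
Local Notation V := 'I_n.

(* Weight [j > 0] is carried by the single vertex [k.-1 + (r - j)]; all later
   vertices have weight 0. *)
Let A : {set V} := [set v : V | v < k.-1].
Let w (v : V) : nat := r - (v - k.-1).

(** An edge meeting [A] is its own colour, so these edges are rainbow. Weights are at most [r < 3],
    so [inord] never falls back on its default. *)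
Definition extremal_coloring (e : {set V}) : {set V} + 'I_3 :=
  if [disjoint e & A] then inr (inord (\max_(v in e) w v)) else inl e.
Local Notation c := extremal_coloring.

Lemma extremal_outside x y : x != y -> x \notin A -> y \notin A ->
  c [set x; y] = inr (inord (maxn (w x) (w y))).
Proof.
move=> nxy xA yA; rewrite /c ifT; last first.
  rewrite -setI_eq0; apply/eqP/setP=> v; rewrite !inE.
  case: eqVneq => [->|_]; first by move: xA; rewrite inE => /negPf.
  by case: eqVneq => [->|//]; move: yA; rewrite inE => /negPf.
by rewrite big_setU1 ?inE // big_set1.
Qed.

(** At most [k - 1] vertices of [A], [r] of positive weight and [2 * (k - 1) + 2] of weight 0:
    [3 * k + r - 1] in all. *)
Lemma extremal_path (s : seq V) : uniq s -> pc c s -> size s < 3 * k + r.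
Proof.
move=> us ps.
have cA : count (mem A) s <= k.-1.
  rewrite -size_filter -(@card_ord_below n k.-1); last by move: kn; clear; lia.
  rewrite -(card_uniqP (filter_uniq _ us)); apply/subset_leq_card/subsetP=> v.
  by rewrite mem_filter => /andP[].
pose X := [set v : V | k.-1 <= v < k.-1 + r].
have cX : count (mem X) s <= r.
  have cX' : #|X| <= r.
    have : #|[set v : V | v < k.-1 + r]| = #|A| + #|X|.
      rewrite -[LHS](cardsID A); congr (_ + _); apply: eq_card => v; rewrite !inE; lia.
    rewrite !card_ord_below; [clear; lia | move: kn; clear; lia | move: kn; clear; lia].
  apply: leq_trans cX'; rewrite -size_filter.
  rewrite -(card_uniqP (filter_uniq _ us)); apply/subset_leq_card/subsetP=> v.
  by rewrite mem_filter => /andP[].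
have cZ : count [pred v | (v \notin A) && (w v == 0)] s <= 2 * count (mem A) s + 2.
  apply: (zero_weight_count (c := c)) => // x y z.
  rewrite /= !inE !negb_or -!andbA => /and4P[nxy _ nyz _] xA yA zA e.
  by rewrite /col !extremal_outside ?inE // e.
have : size s <= count (mem A) s + count (mem X) s +
    count [pred v | (v \notin A) && (w v == 0)] s.
  elim: s {us ps cA cX cZ} => //= v s IH.
  have : 1 <= (v \in A) + (v \in X) + ((v \notin A) && (w v == 0)).
    by rewrite !inE /w; clear; lia.
  by move: IH; clear; lia.
by move: cA cX cZ k0; clear; lia.
Qed.

Lemma extremal_colors : (k - 1) * n - 'C(k, 2) + 1 + r <=
  #|c @: edges (complete_graph n)|.
Proof.
pose EA := [set e : {set V} | (#|e| == 2) && ~~ [disjoint e & A]].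
pose S1 := [set (inl e : ({set V} + 'I_3)%type) | e in EA].
pose S2 := [set (inr (inord j) : ({set V} + 'I_3)%type) | j : 'I_r.+1].
have cA : #|A| = k.-1 by rewrite card_ord_below //; move: kn; clear; lia.
have cS1 : #|S1| = #|EA| by apply: card_imset => e e' [].
have cS2 : #|S2| = r.+1.
  rewrite card_imset ?card_ord // => i j [] /(congr1 val) /=.
  rewrite !inordK; try by [apply: leq_trans (ltn_ord i) _ | apply: leq_trans (ltn_ord j) _].
  exact: val_inj.
have cU : #|S1 :|: S2| = #|S1| + #|S2|.
  rewrite cardsU; suff -> : S1 :&: S2 = set0 by rewrite cards0 subn0.
  apply/setP=> x; rewrite !inE; apply/negP=> /andP[/imsetP[e _ ->] /imsetP[j _]].
  by [].
have sub : S1 :|: S2 \subset c @: edges (complete_graph n).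
  apply/subsetP=> x; rewrite in_setU => /orP[/imsetP[e eA ->]|/imsetP[j _ ->]].
    move: eA; rewrite inE => /andP[e2 dA]; apply/imsetP; exists e.
      by rewrite complete_edges.
    by rewrite /c (negPf dA).
  (* Colour [j] appears between the vertex at [k.-1 + (r - j)], which has weight [j], and the last
     vertex, which has weight 0. *)
  have h1 : k.-1 + (r - j) < n by move: kn k0; clear; lia.
  have h2 : n.-1 < n by move: kn; clear; lia.
  have nxy : Ordinal h1 != Ordinal h2.
    by apply/eqP=> /(congr1 val) /=; move: kn k0; clear; lia.
  apply/imsetP; exists [set Ordinal h1; Ordinal h2].
    by rewrite complete_edges cards2 nxy.
  rewrite extremal_outside //; last 2 first.
  - by rewrite inE /=; clear; lia.
  - by rewrite inE /=; move: kn; clear; lia.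
  congr (inr (inord _)); rewrite /w /=; have := ltn_ord j.
  by move: kn k0; clear; lia.
have cE : 'C(n, 2) <= #|EA| + 'C(#|~: A|, 2).
  rewrite -cards_draws -[n in 'C(n, 2)]card_ord -card_draws.
  apply: leq_trans (leq_card_setU _ _); apply/subset_leq_card/subsetP=> e.
  by rewrite !inE -disjoints_subset => ->; case: [disjoint _ & _].
have := subset_leq_card sub; rewrite cU cS1 cS2; move=> h; apply: leq_trans h.
have := cardsC A; rewrite cA card_ord => cC.
move: cC cE (bin2_double n) (bin2_double k) (bin2_double #|~: A|) k0; clear.
set m := #|~: A|; set x := #|EA|; clearbody m x.
case: k => // k' /= <-; rewrite subn1 /=.
set b1 := 'C(_, 2); set b2 := 'C(_, 2); set b3 := 'C(_, 2) => h1 h2 h3 h4 _.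
clearbody b1 b2 b3; suff : k' * (k' + m) <= b3 + x by lia.
by nia.
Qed.

End LowerBound.

Theorem theorem3 (l r n : nat) (hl : 27 <= l) (hr : r < 3)
    (hlr : l = r %[mod 3]) (hn : 2 * l ^ 3 <= n) :
  pr (complete_graph n) (path_graph l) =
    (l %/ 3 - 1) * n - 'C(l %/ 3, 2) + 1 + r.
Proof.
have lk : l = 3 * (l %/ 3) + r.
  by rewrite {1}(divn_eq l 3) hlr (modn_small hr) mulnC.
have l0 : 0 < l by move: hl; clear; lia.
have ln : l <= n by apply: leq_trans hn; rewrite !expnS; move: hl; clear; nia.
set k := l %/ 3 in lk *.
have k0 : 0 < k by move: hl lk hr; clear; lia.
have kn : k + r + 1 <= n by move: ln hl lk hr; clear; lia.
apply/eqP; rewrite eqn_leq; apply/andP; split; last first.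
  apply: leq_trans (extremal_colors k0 hr kn) _.
  apply: (@pr_max (complete_graph n) (path_graph l) _ (@extremal_coloring n k r)).
  apply/negP=> /pc_copy_seq[s [us ps sz]].
  by have := extremal_path k0 hr kn us ps; rewrite sz -lk ltnn.
apply/bigmax_leqP=> c nc.
have nopath (s : seq 'I_n) : uniq s -> pc c s -> size s < l.
  (* A longer path is cut down to exactly [l] vertices. *)
  move=> us ps; rewrite ltnNge; apply: contra nc => ls.
  apply: (@seq_pc_copy _ _ _ l (drop (size s - l) s)) => //.
  - exact: drop_uniq.
  - exact: pc_drop.
  - by rewrite size_drop subKn.
(* One edge is chosen for each colour; the default [set0] is never taken for a colour that
   occurs. *)
pose rep (g : 'I_#|edges (complete_graph n)|) : {set 'I_n} :=
  odflt set0 [pick e in edges (complete_graph n) | c e == g].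
have repP g : g \in c @: edges (complete_graph n) ->
    rep g \in edges (complete_graph n) /\ c (rep g) = g.
  case/imsetP=> e eE ->; rewrite /rep; case: pickP => [e' /andP[e'E /eqP]//|/(_ e)].
  by rewrite eE eqxx.
pose E := rep @: (c @: edges (complete_graph n)).
have cE : {in E &, injective c}.
  move=> _ _ /imsetP[g gE ->] /imsetP[g' g'E ->].
  by have [_ ->] := repP g gE; have [_ ->] := repP g' g'E => ->.
have E2 e : e \in E -> #|e| = 2.
  case/imsetP=> g gE ->; have [h _] := repP g gE.
  by move: h; rewrite complete_edges => /eqP.
have -> : num_colors c = #|E|.
  rewrite /num_colors /E card_in_imset // => g g' gE g'E e.
  by have [_ <-] := repP g gE; rewrite e; have [_ ->] := repP g' g'E.
rewrite -[n in _ * n]card_ord.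
apply: (rainbow_edges_bound nopath E2 cE hl hr lk).
by rewrite card_ord.
Qed.
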